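(* There exist four fixed straight-line programs $\mathcal A_1,\mathcal A_2,\mathcal A_3,\mathcal A_4$ (each one a single program, independent of $d$) such that for every nonsquare integer $d\ge2$, each of them, on input $d$, returns the fundamental solution $(X_1,Y_1)$ of $x^2-dy^2=1$, and such that: (1) $\mathcal A_1$ uses $94$ operations, and all of its intermediate values on input $d$ have bit length at most $2^{2^{2^{O(d)}}}$; (2) $\mathcal A_2$ uses $98$ operations, and all of its intermediate values on input $d$ have bit length at most $2^{2^{O(d)}}$; (3) $\mathcal A_3$ uses $103$ operations, and all of its intermediate values on input $d$ have bit length at most $2^{2^{2^{O(\sqrt d\log d)}}}$; (4) $\mathcal A_4$ uses $107$ operations, and all of its intermediate values on input $d$ have bit length at most $2^{2^{O(\sqrt d\log d)}}$.
   Context: The fundamental solution $(X_1,Y_1)$ of $x^2-dy^2=1$ is the solution in integers $X_1,Y_1>0$ with $X_1$ least. All values are in $\mathbb N=\{0,1,2,\dots\}$. A straight-line program is a finite sequence of assignments, with no loop or input-dependent branch, each applying one of the six operations $u+v$, $u\mathbin{\dot{-}}v=\max(u-v,0)$, $uv$, $\lfloor u/v\rfloor$, $u^v$, $u\bmod v$ (with positive divisors $v$ in division and remainder) to inputs, constant natural numbers, or previously computed values. Each application of one of the six operations counts as one operation; constants, assignments, and reuse of previously computed values are free. Intermediate values are all values computed by the program. The constants implied by $O(\cdot)$ are absolute (they depend on the program only). *)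

(* Defs.v *)
From mathcomp Require Import all_boot all_order all_algebra.
From mathcomp Require Import reals exp.

Set Implicit Arguments.
Unset Strict Implicit.
Unset Printing Implicit Defensive.

Import Order.TTheory GRing.Theory Num.Theory.

Local Open Scope ring_scope.

Definition pell (d : nat) (x y : int) : Prop := x ^+ 2 - d%:Z * y ^+ 2 = 1.

Definition fundamental_solution (d X Y : nat) : Prop :=
  [/\ (0 < X)%N, (0 < Y)%N, pell d X%:Z Y%:Z &
      forall x y : int, 0 < x -> 0 < y -> pell d x y -> X%:Z <= x].

Definition nonsquare (d : nat) : Prop := ~ exists k : nat, d = (k ^ 2)%N.

Inductive operation := OpAdd | OpMonus | OpMul | OpDiv | OpPow | OpMod.

(* [Value j] is the value computed by the j-th instruction, from 0. *)
Inductive operand := Input of nat | Const of nat | Value of nat.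

Inductive instruction :=
  | Assign of operand
  | Apply of operation & operand & operand.

Record slp := Slp { code : seq instruction; outputs : seq operand }.

Definition is_apply (i : instruction) : bool :=
  if i is Apply _ _ _ then true else false.

Definition op_count (p : slp) : nat := count is_apply (code p).

(* Division and remainder by 0 are undefined, so that a program which performs
   one has no trace; the power 0 ^ 0 is 1. *)
Definition eval_operation (o : operation) (u v : nat) : option nat :=
  match o with
  | OpAdd => Some (u + v)%N
  | OpMonus => Some (u - v)%N
  | OpMul => Some (u * v)%N
  | OpDiv => if v == 0%N then None else Some (u %/ v)%N
  | OpPow => Some (u ^ v)%N
  | OpMod => if v == 0%N then None else Some (u %% v)%N
  end.

(* [xs] lists the inputs and [vs] the values computed so far, oldest first;
   a reference to a missing input or to a value not yet computed is undefined. *)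
Definition eval_operand (xs vs : seq nat) (a : operand) : option nat :=
  match a with
  | Input i => onth xs i
  | Const c => Some c
  | Value j => onth vs j
  end.

Definition eval_instruction (xs vs : seq nat) (i : instruction) : option nat :=
  match i with
  | Assign a => eval_operand xs vs a
  | Apply o a b =>
      if eval_operand xs vs a is Some u then
        if eval_operand xs vs b is Some v then eval_operation o u v else None
      else None
  end.

Fixpoint run (xs vs : seq nat) (c : seq instruction) : option (seq nat) :=
  if c is i :: c' then
    if eval_instruction xs vs i is Some v then run xs (rcons vs v) c' else None
  else Some vs.

(* The intermediate values of [p] on the inputs [xs]. *)
Definition trace (p : slp) (xs : seq nat) : option (seq nat) :=
  run xs [::] (code p).

Definition returns (p : slp) (xs ys : seq nat) : Prop :=
  exists2 vs : seq nat, trace p xs = Some vs &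
    [seq eval_operand xs vs a | a <- outputs p] = [seq Some y | y <- ys].

Definition solves_pell (p : slp) : Prop :=
  forall d : nat, (2 <= d)%N -> nonsquare d ->
  exists X Y : nat, fundamental_solution d X Y /\ returns p [:: d] [:: X; Y].

(* The value 0 is given one bit. *)
Definition bit_length (n : nat) : nat := (trunc_log 2 n).+1.

(* Bit lengths at most g(O(f(d))), for all d under consideration and not only
   for large ones; f is positive and g increasing in every use. *)
Definition bit_length_bound (R : realType) (p : slp) (g : R -> R)
    (f : nat -> R) : Prop :=
  exists2 C : R, 0 < C &
  forall d : nat, (2 <= d)%N -> nonsquare d ->
  forall vs : seq nat, trace p [:: d] = Some vs ->
  forall v : nat, v \in vs -> (bit_length v)%:R <= g (C * f d).

(* Main.v *)
Require Import Defs.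
From mathcomp Require Import all_boot all_order all_algebra.
From mathcomp Require Import reals sequences exp.
From mathcomp Require Import zify ring lra.

Import Order.TTheory GRing.Theory Num.Theory.

Local Open Scope nat_scope.

(** One program, with idle additions appended to reach each of the four
operation counts, proves all four claims.  Its values have bit length
2^(2^(O(sqrt d log d))), which is also 2^(2^(O(d))), and raising the tower by
one level only weakens the bound.

The program searches all pairs (x, y) with x, y < n at once, where n exceeds
the fundamental solution.  The pair of index i = x n + y gets one digit, in a
base 2^q, of each of two numbers a and b: with f = x^2 - d y^2 - 1 and
T = 2^(n + L i) the digits are T + f and T - 1.  The 2-adic valuation of
C(2T + f - 1, T - 1) is 0 when f = 0 and lies between L i and L i + n + 1 when
f <> 0 [logn_bin_compare], because for f <> 0 the addition of the two digits
carries from the lowest set bit of f on through the ones of T - 1, while for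
f = 0 nothing carries.
Valuations of separate digits add up [logn_bin_cat], so for large L the
quotient by L of the valuation of C(a + b, b) is the sum of the indices of the
pairs that are not solutions [search_count].  Subtracting it from the sum of
all indices leaves the sum of X_k n + Y_k over the solutions (X_k, Y_k) with
X_k < n, which are the powers of the fundamental one [sum_solutions].  Since
the Y_k sum to less than n, division by n separates the sum of the X_k from
that of the Y_k, and the fundamental solution is a rational function of those
two sums [pell_recover].

Each of these numbers has a closed form.  The digits of a and b are
polynomials in x and y times powers of 2, so a and b are quotients of
geometric type [search_digit_values]; a binomial coefficient is a digit of
(2^N + 1)^N [bin_digit]; the power of 2 in it is a gcd with a power of 2, read
off from a geometric sum modulo y^r - 1 [gcd_by_powers]; and the exponent
comes from expanding (1 + v)^K modulo v^2 [log_by_powers].  The binomial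
coefficient is first reduced modulo a power of 2 of bit length polynomial in n,
so that no value exceeds 2^(2^(n^129)).

It remains to find n = 2^(O(sqrt d log d)).  Take n = (2d)^(128 s), where
s = floor(4^d / C(2d, d)) is of the order of sqrt d.  To see that it is large
enough, approximate sqrt d by p/q with q <= 2^j for j = 1, 2, and so on.  The
norm m = |p^2 - d q^2| is O(sqrt d), and two approximations of equal signed
norm and equal residue p/q modulo m differ by a unit [norm_quotient].  One
approximation serves at most about log(sqrt d / m) scales j, so by the
pigeonhole principle a solution has size exponential in the sum of
rho(m) log(sqrt d / m) over m = O(sqrt d), where rho(m) is the number of square
roots of d modulo m.  An injection of the pairs (m, t) with t^2 = d mod m into
the pairs (b, v) with b v <= m [root_code_inj] bounds the sum of rho(m) over
m <= Z by Z (1 + log Z), uniformly in d, and hence the exponent by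
O(sqrt d log d) [small_solution]. *)

(** * Valuations of binomial coefficients *)

(** The 2-adic valuation of n!.  Legendre's formula enters only through the
halving recursion and its consequence for concatenated binary words. *)
Definition v2fact (n : nat) : nat := logn 2 n`!.

Lemma v2factS n : v2fact n.+1 = logn 2 n.+1 + v2fact n.
Proof. by rewrite /v2fact factS lognM ?fact_gt0. Qed.

Lemma logn2_odd n : odd n -> logn 2 n = 0.
Proof. by move=> on; rewrite lognE dvdn2 on andbF. Qed.

Lemma v2fact_double n : v2fact n.*2 = n + v2fact n.
Proof.
elim: n => [|n IH]; first by [].
rewrite doubleS !v2factS IH -doubleS (@logn2_odd n.*2.+1) /= ?odd_double //.
rewrite -muln2 lognM // (@logn_prime 2 2) //=; lia.
Qed.

Lemma v2fact_bit (b : bool) n : v2fact (b + n.*2) = n + v2fact n.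
Proof.
case: b; last exact: v2fact_double.
by rewrite v2factS logn2_odd /= ?odd_double // v2fact_double.
Qed.

(** Legendre's formula says v2(n!) = n - s(n) with s the binary digit sum, and
digit sums of concatenated words add; halving proves this without s. *)
Lemma v2fact_cat k lo hi : lo < 2 ^ k ->
  v2fact (lo + 2 ^ k * hi) = v2fact lo + v2fact hi + (2 ^ k - 1) * hi.
Proof.
elim: k lo => [|k IH] lo.
  by rewrite ltnS leqn0 => /eqP ->; rewrite mul1n mul0n addn0.
move=> hlo; have e2 : lo = odd lo + lo./2.*2 by rewrite odd_double_half.
have h2 : lo./2 < 2 ^ k by rewrite ltn_half_double -mul2n -expnS.
have -> : lo + 2 ^ k.+1 * hi = odd lo + (lo./2 + 2 ^ k * hi).*2.
  by rewrite doubleD addnA -e2 expnS -mul2n mulnA.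
have -> : v2fact lo = lo./2 + v2fact lo./2 by rewrite -(v2fact_bit (odd lo)) -e2.
rewrite v2fact_bit IH // expnS.
have : 0 < 2 ^ k by rewrite expn_gt0.
move: (2 ^ k) => K; nia.
Qed.

Lemma logn_bin_v2fact A B :
  logn 2 'C(A + B, B) + v2fact A + v2fact B = v2fact (A + B).
Proof.
rewrite /v2fact -(@bin_fact (A + B) B) ?leq_addl // addnK.
rewrite lognM ?bin_gt0 ?leq_addl ?muln_gt0 ?fact_gt0 // lognM ?fact_gt0 //; lia.
Qed.

(** Kummer's theorem for blocks: no carry leaves the low block, so the carries
of the two blocks are counted separately. *)
Lemma logn_bin_cat k A B a b : a + b < 2 ^ k ->
  logn 2 'C(2 ^ k * A + a + (2 ^ k * B + b), 2 ^ k * B + b) =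
  logn 2 'C(A + B, B) + logn 2 'C(a + b, b).
Proof.
move=> hab.
have := logn_bin_v2fact (2 ^ k * A + a) (2 ^ k * B + b).
have := logn_bin_v2fact A B; have := logn_bin_v2fact a b.
have cat u v : u < 2 ^ k ->
    v2fact (2 ^ k * v + u) = v2fact u + v2fact v + (2 ^ k - 1) * v.
  by move=> hu; rewrite addnC v2fact_cat.
have -> : v2fact (2 ^ k * A + a + (2 ^ k * B + b)) =
          v2fact (2 ^ k * (A + B) + (a + b)) by congr v2fact; lia.
rewrite !cat; [|lia..].
by rewrite mulnDr; lia.
Qed.

Lemma v2fact_pow2_pred t : v2fact (2 ^ t - 1) + t = 2 ^ t - 1.
Proof.
elim: t => // t IH; have h : 0 < 2 ^ t by rewrite expn_gt0.
have -> : 2 ^ t.+1 - 1 = true + (2 ^ t - 1).*2 by rewrite expnS -mul2n /=; lia.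
rewrite v2fact_bit /= -mul2n; lia.
Qed.

(** T + (T - 1) has no carry when T is a power of 2; this is how a solution
becomes visible. *)
Lemma logn_bin_digit0 t : logn 2 'C(2 ^ t + (2 ^ t - 1), 2 ^ t - 1) = 0.
Proof.
have h : 0 < 2 ^ t by rewrite expn_gt0.
have := logn_bin_v2fact (2 ^ t) (2 ^ t - 1).
have -> : 2 ^ t + (2 ^ t - 1) = (2 ^ t - 1) + 2 ^ t * 1 by lia.
rewrite v2fact_cat ?subn1 ?prednK // -subn1.
have : v2fact (2 ^ t) = v2fact 0 + v2fact 1 + (2 ^ t - 1) * 1.
  by rewrite -v2fact_cat // muln1.
lia.
Qed.

(** A carry starts at the lowest set bit of f, runs through the ones of T - 1 and
passes the bit T of the other summand. *)
Lemma logn_bin_digit_pos t f : 0 < f -> f < 2 ^ t ->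
  logn 2 'C(2 ^ t + f + (2 ^ t - 1), 2 ^ t - 1) + logn 2 f = t.+1.
Proof.
move=> f0 ft; have := logn_bin_v2fact (2 ^ t + f) (2 ^ t - 1).
have h := ltn_trans f0 ft; have e := v2fact_pow2_pred t.
have -> : 2 ^ t + f + (2 ^ t - 1) = (f - 1) + 2 ^ t.+1 * 1 by rewrite expnS; lia.
rewrite v2fact_cat ?expnS; last lia.
have -> : 2 ^ t + f = f + 2 ^ t * 1 by lia.
rewrite v2fact_cat //.
have -> : v2fact f = logn 2 f + v2fact (f - 1) by case: (f) f0 => // f' _; rewrite subn1 v2factS.
rewrite /= !muln1; lia.
Qed.

(** The lowest set bit of T - f is that of f.  From there on the ones of T - 1 pass
the carry along, but at the bit T no summand has a one. *)
Lemma logn_bin_digit_neg t f : 0 < f -> f < 2 ^ t ->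
  logn 2 'C(2 ^ t - f + (2 ^ t - 1), 2 ^ t - 1) + logn 2 f = t.
Proof.
move=> f0 ft; have := logn_bin_v2fact (2 ^ t - f) (2 ^ t - 1).
have h := ltn_trans f0 ft; have e := v2fact_pow2_pred t.
have -> : 2 ^ t - f + (2 ^ t - 1) = (2 ^ t - 1 - f) + 2 ^ t * 1 by lia.
rewrite v2fact_cat; last lia.
have -> : v2fact (2 ^ t - f) = logn 2 (2 ^ t - f) + v2fact (2 ^ t - 1 - f).
  have e3 : 2 ^ t - f = (2 ^ t - 1 - f).+1 by lia.
  by rewrite e3 v2factS.
have -> : logn 2 (2 ^ t - f) = logn 2 f.
  have lt : logn 2 f < t.
    by rewrite -(@ltn_exp2l 2) // (leq_ltn_trans _ ft) // dvdn_leq // pfactor_dvdnn.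
  rewrite -{1}(subnK (ltnW lt)) expnD.
  have [m cm em] := @pfactor_coprime 2 f isT f0.
  have om : odd m by rewrite coprime2n in cm.
  have h2 : 0 < 2 ^ logn 2 f by rewrite expn_gt0.
  rewrite {3}em -mulnBl lognM //; last first.
    by rewrite subn_gt0; move: ft; rewrite {1}em -{1}(subnK (ltnW lt)) expnD ltn_pmul2r.
  rewrite pfactorK // logn2_odd // oddB; last first.
    by move: ft; rewrite {1}em -{1}(subnK (ltnW lt)) expnD ltn_pmul2r // => /ltnW.
  by rewrite oddX om -[t - _]prednK ?subn_gt0.
rewrite muln1 (_ : v2fact 1 = 0) //; lia.
Qed.

(** * Binomial coefficients, gcds and logarithms by powers *)

Lemma bin_lt_exp2 N k : 0 < N -> 'C(N, k) < 2 ^ N.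
Proof.
case: N => // N _; elim: N k => [|N IH] [|k]; rewrite ?bin0 ?expn1 //.
- by rewrite binS !bin0n; case: k.
- by rewrite -[1]/(2 ^ 0) ltn_exp2l.
rewrite binS expnS mul2n -addnn -addSn leq_add ?IH //; exact: ltnW (IH _).
Qed.

Lemma ltn_digits P (c : nat -> nat) a : (forall i, c i < P) ->
  \sum_(i < a) c i * P ^ i < P ^ a.
Proof.
move=> cP; elim: a => [|a IH]; first by rewrite big_ord0.
rewrite big_ord_recr /= expnS; have := cP a; move: IH.
move: (P ^ a) (\sum_(_ < _) _) (c a) => Pa S ca; nia.
Qed.

(** The digits of (P + 1)^N in base P are the binomial coefficients. *)
Lemma bin_digit P M N a : (forall i, 'C(N, i) < P) -> M %| P -> a <= N ->
  ((P + 1) ^ N %/ P ^ a) %% M = 'C(N, a) %% M.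
Proof.
move=> cP MP aN; have P0 : 0 < P by apply: leq_ltn_trans (cP 0).
have -> : (P + 1) ^ N = \sum_(0 <= i < N.+1) 'C(N, i) * P ^ i.
  rewrite addnC expnDn big_mkord; apply: eq_bigr => i _.
  by rewrite exp1n mul1n.
rewrite (big_cat_nat (leq0n a)) /=; last exact: leqW.
rewrite [X in _ + X]big_ltn // big_mkord.
have -> : \sum_(a.+1 <= i < N.+1) 'C(N, i) * P ^ i =
   (\sum_(a.+1 <= i < N.+1) 'C(N, i) * P ^ (i - a.+1)) * P * P ^ a.
  rewrite -mulnA -expnS big_distrl; apply: eq_big_nat => i /andP[ai _] /=.
  by rewrite -mulnA -expnD subnK.
rewrite -mulnDl addnC divnMDl ?expn_gt0 ?P0 // divn_small ?addn0; last first.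
  exact: (ltn_digits _ (fun i => 'C(N, i)) _ cP).
by rewrite -modnDmr -modnMmr (eqP MP) muln0 mod0n addn0.
Qed.

Lemma geom_sum q n : 1 < q -> q ^ n = (q - 1) * (\sum_(i < n) q ^ i) + 1.
Proof.
move=> q1; elim: n => [|n IH]; first by rewrite big_ord0 muln0.
rewrite big_ord_recr /= mulnDr addnAC -IH expnS; nia.
Qed.

Lemma divn_geom q n : 2 < q -> q ^ n %/ (q - 1) = \sum_(i < n) q ^ i.
Proof.
move=> q2; rewrite geom_sum; last lia.
rewrite mulnC divnMDl ?divn_small ?addn0 //; lia.
Qed.

(** Multiplication by a unit permutes the residues modulo r. *)
Lemma sum_mod_coprime (F : nat -> nat) a r : coprime a r -> 0 < r ->
  \sum_(t < r) F ((a * t) %% r) = \sum_(s < r) F s.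
Proof.
case: r => // r cop _.
pose h (t : 'I_r.+1) : 'I_r.+1 := inord ((a * t) %% r.+1).
have hE t : h t = (a * t) %% r.+1 :> nat by rewrite inordK // ltn_mod.
have h_inj : injective h.
  move=> t u /(congr1 val) /=; rewrite !hE => /eqP.
  wlog le_tu : t u / t <= u.
    by case/orP: (leq_total t u) => le W e; [|symmetry]; apply: W => //; rewrite eq_sym.
  rewrite eq_sym eqn_mod_dvd ?leq_mul2l ?le_tu ?orbT // -mulnBr Gauss_dvdr; last first.
    by rewrite coprime_sym.
  move=> dv; apply/val_inj/eqP; rewrite /= eqn_leq le_tu /=.
  rewrite -subn_eq0; apply: contraLR dv; rewrite -lt0n => h0.
  by rewrite gtnNdvd // (leq_ltn_trans (leq_subr _ _)).
rewrite [RHS](reindex_inj h_inj) /=; apply: eq_bigr => t _.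
by rewrite hE.
Qed.

(** Modulo y^r - 1 the exponents of y count modulo r.  The multiples of A run
through the multiples of the gcd, each hit gcd times, so the reduced sum has the
gcd as its lowest digit in base y. *)
Lemma gcd_by_powers y A r : 2 < y -> 0 < r -> gcdn A r < y ->
  ((\sum_(t < r) (y ^ A) ^ t) %% (y ^ r - 1)) %% y = gcdn A r.
Proof.
move=> y2 r0; set g := gcdn A r => gy.
have g0 : 0 < g by rewrite gcdn_gt0 r0 orbT.
have [r' er] := dvdnP (dvdn_gcdr A r); have [A' eA] := dvdnP (dvdn_gcdl A r).
rewrite -/g in er eA.
have cop : coprime A' r'.
  rewrite /coprime -(eqn_pmul2r g0) mul1n.
  by rewrite muln_gcdl -er -eA.
have r'0 : 0 < r' by move: r0; rewrite er muln_gt0 => /andP[].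
pose Y := y ^ g; pose S := \sum_(s < r') Y ^ s.
have gY : g < Y - 1.
  rewrite /Y; case: (g) g0 gy => // -[|k] _ gy; first by rewrite expn1; lia.
  have := ltn_expl k.+2 (ltnW y2).
  have : y * y <= y ^ k.+2 by rewrite !expnS mulnA leq_pmulr // expn_gt0; lia.
  nia.
have eyr : y ^ r - 1 = (Y - 1) * S.
  by rewrite er mulnC expnM -/Y geom_sum ?addnK //; lia.
have S1 : S = 1 + Y * (\sum_(s < r'.-1) Y ^ s).
  rewrite /S -[in LHS](prednK r'0) big_ord_recl big_distrr /=; congr (_ + _).
  by apply: eq_bigr => i _; rewrite /bump leq0n add1n expnS.
have modY : forall e, Y ^ e = Y ^ (e %% r') %[mod (Y - 1) * S].
  move=> e; rewrite {1}(divn_eq e r') expnD (mulnC (e %/ r')) expnM.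
  have -> : Y ^ r' = (Y - 1) * S + 1 by rewrite /S -geom_sum //; lia.
  have D1 : ((Y - 1) * S + 1) ^ (e %/ r') = 1 %[mod (Y - 1) * S].
    by rewrite -modnXm -modnDml modnn add0n modnXm exp1n.
  by rewrite -modnMml D1 modnMml mul1n.
have -> : (\sum_(t < r) (y ^ A) ^ t) %% (y ^ r - 1) = (g * S) %% ((Y - 1) * S).
  rewrite eyr er mulnC; move: modY; set D := (Y - 1) * S; move=> modY.
  rewrite -(big_mkord xpredT (fun t => (y ^ A) ^ t)) big_nat_mul big_mkord.
  rewrite -modn_summ.
  have -> : g * S = \sum_(j < g) S by rewrite sum_nat_const card_ord.
  rewrite -[in RHS]modn_summ; congr (_ %% _); apply: eq_bigr => j _.
  rewrite /S -[in RHS](sum_mod_coprime (fun s => Y ^ s) A' r' cop r'0).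
  rewrite -(add0n (j * r')) big_addn mulSn addnK big_mkord.
  rewrite -modn_summ -[in RHS]modn_summ; congr (_ %% _).
  apply: eq_bigr => t _ /=; rewrite eA (mulnC A') -!expnM -mulnA expnM -/Y modY.
  by rewrite mulnDr mulnA addnC modnMDl /Y expnM.
rewrite (modn_small (m := g * S)); last by rewrite ltn_pmul2r // S1.
rewrite S1 mulnDr muln1 mulnCA /Y.
by case: (g) g0 gy => // k _ gy; rewrite expnS -mulnA (mulnC y) addnC modnMDl modn_small.
Qed.

(** With v = 2^L - 1, the power (2^K)^L = (1 + v)^K is 1 + K v modulo v^2. *)
Lemma log_by_powers K L : K.+1 < 2 ^ L -> 1 < L ->
  ((2 ^ K) ^ L %% (2 ^ L - 1) ^ 2) %/ (2 ^ L - 1) = K.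
Proof.
move=> KL L1; rewrite -expnM mulnC expnM.
set v := 2 ^ L - 1; have v2 : 2 < v.
  have : 2 ^ 2 <= 2 ^ L by rewrite leq_exp2l.
  by rewrite /v; lia.
have -> : 2 ^ L = 1 + v by rewrite /v; lia.
have -> : (1 + v) ^ K = 1 + K * v %[mod v ^ 2].
  elim: (K) => [|k IH]; first by rewrite mul0n expn0.
  rewrite expnS -modnMmr IH modnMmr.
  have -> : (1 + v) * (1 + k * v) = k * v ^ 2 + (1 + k.+1 * v) by rewrite -mulnn; lia.
  by rewrite modnMDl.
rewrite modn_small; last by rewrite -mulnn; move: KL; rewrite /v; nia.
by rewrite addnC divnMDl ?divn_small ?addn0 //; lia.
Qed.

(** * Numbers with prescribed digits *)

(** The most significant digit comes first, so that partial sums of power series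
in 1/Q are integer parts of rational functions of Q. *)
Definition digits (Q : nat) (u : nat -> nat) (m : nat) : nat :=
  \sum_(i < m) u i * Q ^ (m.-1 - i).

Lemma digits0 Q u : digits Q u 0 = 0.
Proof. by rewrite /digits big_ord0. Qed.

Lemma digitsS Q u m : digits Q u m.+1 = Q * digits Q u m + u m.
Proof.
rewrite /digits big_ord_recr /= subnn muln1 big_distrr /=; congr (_ + _).
apply: eq_bigr => i _; rewrite mulnCA -expnS; congr (_ * Q ^ _).
by have := ltn_ord i; lia.
Qed.

Lemma eq_digits Q u v m : (forall i, i < m -> u i = v i) -> digits Q u m = digits Q v m.
Proof. by move=> e; apply: eq_bigr => i _; rewrite e. Qed.

Lemma digitsD Q u v m :
  digits Q (fun i => u i + v i) m = digits Q u m + digits Q v m.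
Proof. by rewrite /digits -big_split; apply: eq_bigr => i _; rewrite mulnDl. Qed.

Lemma digitsZ Q c u m : digits Q (fun i => c * u i) m = c * digits Q u m.
Proof. by rewrite /digits big_distrr; apply: eq_bigr => i _ /=; rewrite mulnA. Qed.

Lemma leq_digits Q u v m : (forall i, u i <= v i) -> digits Q u m <= digits Q v m.
Proof. by move=> le; apply: leq_sum => i _; rewrite leq_mul2r le orbT. Qed.

Lemma digits_cat Q u m k :
  digits Q u (m + k) = Q ^ k * digits Q u m + digits Q (fun i => u (m + i)) k.
Proof.
elim: k => [|k IH]; first by rewrite digits0 mul1n !addn0.
by rewrite addnS !digitsS IH expnS; ring.
Qed.

(** Product digits on a grid of k rows of length n, row by row, factor into a
number in base Q^n and a number in base Q. *)
Lemma digits_pair Q u v n k :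
  digits Q (fun i => u (i %/ n) * v (i %% n)) (k * n) =
  digits (Q ^ n) u k * digits Q v n.
Proof.
elim: k => [|k IH]; first by rewrite mul0n !digits0.
rewrite mulSn addnC digits_cat IH digitsS mulnDl mulnA; congr (_ + _).
rewrite -digitsZ; apply: eq_digits => i i_n.
by rewrite divnMDl ?(leq_ltn_trans _ i_n) // divn_small // addn0 modnMDl modn_small.
Qed.

Lemma digits_geom Q c m : c < Q ->
  Q ^ m = (Q - c) * digits Q (fun i => c ^ i) m + c ^ m.
Proof.
move=> cQ; elim: m => [|m IH]; first by rewrite digits0 muln0.
rewrite digitsS !expnS [in LHS]IH; move: (digits _ _ _) (c ^ m) => D C; nia.
Qed.

(** The terms beyond the m-th of the series of w / (Q - c) contribute less
than 1. *)
Lemma divn_digits_geom Q c w m : w * c ^ m + c < Q ->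
  Q ^ m * w %/ (Q - c) = digits Q (fun i => w * c ^ i) m.
Proof.
move=> small; have cQ : c < Q by lia.
rewrite digitsZ (digits_geom _ c) // mulnDl mulnC mulnCA mulnC.
rewrite divnMDl ?subn_gt0 // divn_small ?addn0 //; lia.
Qed.

Lemma divn_digits_one Q m : 2 < Q -> Q ^ m %/ (Q - 1) = digits Q (fun => 1) m.
Proof.
move=> Q2; rewrite -[Q ^ m]muln1 divn_digits_geom ?exp1n //.
by apply: eq_digits => i _; rewrite exp1n.
Qed.

(** The sum of i^2 / q^i is q (q + 1) / (q - 1)^3.  The exact remainder
(n (q - 1) + 1)^2 + q is found by solving the recursion for the tail. *)
Lemma divn_digits_sqr q n : n ^ 2 + 2 * n + 3 < q ->
  q ^ n * (q + 1) %/ (q - 1) ^ 3 = digits q (fun i => i ^ 2) n.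
Proof.
move=> small; have e : q ^ n * (q + 1) =
    digits q (fun i => i ^ 2) n * (q - 1) ^ 3 + ((n * (q - 1) + 1) ^ 2 + q).
  have : 0 < q by lia.
  case: (q) => // u _; rewrite subn1 /= {small}.
  elim: n => [|n IH]; first by rewrite digits0 !mul0n !mul1n; lia.
  by rewrite digitsS expnS -mulnA IH; ring.
rewrite e divnMDl ?expn_gt0 ?subn_gt0 ?divn_small ?addn0 //; last by lia.
move: small; case: (q) => // u; rewrite subn1 /= ltnS => h {e}.
have h1 := leq_mul (leqnn (u * u)) h.
have h2 : u <= u * u by rewrite leq_pmulr // (leq_trans _ h) // addn3.
have h3 := leq_mul (leqnn n) h2.
lia.
Qed.

Lemma logn_bin_digits k (u v : nat -> nat) m :
  (forall i, i < m -> u i + v i < 2 ^ k) ->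
  logn 2 'C(digits (2 ^ k) u m + digits (2 ^ k) v m, digits (2 ^ k) v m) =
  \sum_(i < m) logn 2 'C(u i + v i, v i).
Proof.
elim: m => [|m IH] small; first by rewrite !digits0 big_ord0 bin0.
rewrite !digitsS big_ord_recr /= logn_bin_cat ?IH //; last exact: small.
by move=> i im; apply: small; rewrite ltnS ltnW.
Qed.

(** * Searching a table of pairs *)

Lemma logn2_ltn f w : 0 < f -> f < 2 ^ w -> logn 2 f < w.
Proof.
move=> f0 fw; rewrite -(@ltn_exp2l 2) // (leq_ltn_trans _ fw) //.
by rewrite dvdn_leq // pfactor_dvdnn.
Qed.

(** The valuation tests u = v.  The run of ones has length t, and the position of
the first carry, at most w bits from the bottom, is the only uncertainty. *)
Lemma logn_bin_compare u v w t : u < 2 ^ w -> v < 2 ^ w -> w <= t ->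
  let k := logn 2 'C(u + 2 ^ t - v + (2 ^ t - 1), 2 ^ t - 1) in
  if u == v then k == 0 else t - w <= k <= t.+1.
Proof.
move=> uw vw wt /=; have wt2 : 2 ^ w <= 2 ^ t by rewrite leq_exp2l.
case: (ltngtP u v) => [uv|uv|->].
- have f0 : 0 < v - u by lia.
  have := logn_bin_digit_neg t (v - u) f0; have := logn2_ltn (v - u) w f0.
  have -> : u + 2 ^ t - v = 2 ^ t - (v - u) by lia.
  lia.
- have f0 : 0 < u - v by lia.
  have := logn_bin_digit_pos t (u - v) f0; have := logn2_ltn (u - v) w f0.
  have -> : u + 2 ^ t - v = 2 ^ t + (u - v) by lia.
  lia.
by rewrite addKn logn_bin_digit0.
Qed.

(** Index i stands for the pair (i %/ n, i %% n). *)
Definition is_sol (d n i : nat) : bool := (i %/ n) ^ 2 == d * (i %% n) ^ 2 + 1.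

(** The errors, at most n + 1 for each index, add up to less than L and so vanish
in the quotient. *)
Lemma sum_weights (d n L m : nat) (k : nat -> nat) :
  m * (n + 1) < L ->
  (forall i, i < m -> if is_sol d n i then k i == 0 else L * i <= k i <= L * i + n + 1) ->
  m * (m - 1) %/ 2 - (\sum_(i < m) k i) %/ L = \sum_(i < m | is_sol d n i) i.
Proof.
move=> Lbig kP.
have tot : m * (m - 1) %/ 2 = \sum_(i < m) i.
  by rewrite -(big_mkord xpredT (fun i => i)) bin2_sum bin2 divn2 subn1.
rewrite tot (bigID (fun i : 'I_m => is_sol d n i)) /=.
suff -> : (\sum_(i < m) k i) %/ L = \sum_(i < m | ~~ is_sol d n i) i by rewrite addnK.
have [lo hi] : L * (\sum_(i < m | ~~ is_sol d n i) i) <= \sum_(i < m) k i /\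
    \sum_(i < m) k i <= L * (\sum_(i < m | ~~ is_sol d n i) i) + m * (n + 1).
  rewrite big_mkcond big_distrr /=; split.
    apply: leq_sum => i _; have := kP i (ltn_ord i).
    by case: ifP => _; rewrite ?muln0 // => /andP[].
  have -> : m * (n + 1) = \sum_(i < m) (n + 1) by rewrite sum_nat_const card_ord.
  rewrite -big_split /=; apply: leq_sum => i _; have := kP i (ltn_ord i).
  by case: ifP => _ /=; [move/eqP->|rewrite addnA => /andP[]].
apply/eqP; rewrite eqn_leq -ltnS ltn_divLR ?leq_divRL; lia.
Qed.

Lemma search_count (d n L q m : nat) :
  0 < n -> m = n * n -> m * (n + 1) < L -> d * n ^ 2 + 1 < 2 ^ n -> n ^ 2 < 2 ^ n ->
  n + L * m + 2 < q ->
  let A := digits (2 ^ q) (fun i => (i %/ n) ^ 2 + 2 ^ (n + L * i) - (d * (i %% n) ^ 2 + 1)) m in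
  let B := digits (2 ^ q) (fun i => 2 ^ (n + L * i) - 1) m in
  m * (m - 1) %/ 2 - logn 2 'C(A + B, B) %/ L = \sum_(i < m | is_sol d n i) i /\
  logn 2 'C(A + B, B) <= m * (L * m + n + 1).
Proof.
move=> n0 em Lbig hd hn hq A B.
have xs i : i < m -> (i %/ n) ^ 2 < 2 ^ n.
  move=> im; apply: leq_ltn_trans hn; rewrite leq_exp2r // ltnW //.
  by rewrite ltn_divLR // -em.
have ys i : d * (i %% n) ^ 2 + 1 < 2 ^ n.
  apply: leq_ltn_trans hd; rewrite leq_add2r leq_mul2l leq_exp2r //.
  by rewrite ltnW ?orbT // ltn_mod.
pose a i := (i %/ n) ^ 2 + 2 ^ (n + L * i) - (d * (i %% n) ^ 2 + 1).
pose b i := 2 ^ (n + L * i) - 1.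
pose k i := logn 2 'C(a i + b i, b i).
have kP i : i < m ->
    if is_sol d n i then k i == 0 else L * i <= k i <= L * i + n + 1.
  move=> im; have := logn_bin_compare _ _ _ (n + L * i) (xs i im) (ys i) (leq_addr _ _).
  rewrite /is_sol /k /a /b; case: ifP => // _; rewrite addKn -(addn1 (n + L * i)) (addnC n (L * i)).
  by [].
rewrite /A /B (logn_bin_digits q a b); last first.
  move=> i im; rewrite /a /b; apply: (@leq_trans (2 ^ (n + L * m + 2))); last by rewrite leq_exp2l // ltnW.
  have : 2 ^ (n + L * i) <= 2 ^ (n + L * m) by rewrite leq_exp2l // leq_add2l leq_mul2l (ltnW im) orbT.
  have : 2 ^ n <= 2 ^ (n + L * i) by rewrite leq_exp2l // leq_addr.
  have := xs i im; rewrite (expnD 2 (n + L * m) 2); lia.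
split; first exact: (sum_weights d n L m k).
apply: (@leq_trans (\sum_(i < m) (L * m + n + 1))); last by rewrite sum_nat_const card_ord.
apply: leq_sum => i _; rewrite -/(k i); have := kP i (ltn_ord i).
have le : L * i <= L * m by rewrite leq_mul2l ltnW ?orbT.
by case: ifP => _; [move/eqP->|lia].
Qed.

(** * The solutions of Pell's equation *)

(** The k-th power of X + Y sqrt d. *)
Fixpoint pell_power (d X Y k : nat) : nat * nat :=
  if k is k'.+1 then
    let: (x, y) := pell_power d X Y k' in (X * x + d * Y * y, X * y + Y * x)
  else (1, 0).

Definition pellx d X Y k := (pell_power d X Y k).1.
Definition pelly d X Y k := (pell_power d X Y k).2.

Lemma pellxS d X Y k :
  pellx d X Y k.+1 = X * pellx d X Y k + d * Y * pelly d X Y k.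
Proof. by rewrite /pellx /pelly /=; case: pell_power. Qed.

Lemma pellyS d X Y k : pelly d X Y k.+1 = X * pelly d X Y k + Y * pellx d X Y k.
Proof. by rewrite /pellx /pelly /=; case: pell_power. Qed.

Definition minimal_solution (d X Y : nat) : Prop :=
  [/\ 0 < Y, X ^ 2 = d * Y ^ 2 + 1 &
      forall x y, 0 < y -> x ^ 2 = d * y ^ 2 + 1 -> X <= x].

(** The norm form is multiplicative. *)
Lemma brahmagupta (d X Y x y : nat) : X ^ 2 = d * Y ^ 2 + 1 -> x ^ 2 = d * y ^ 2 + 1 ->
  (X * x + d * Y * y) ^ 2 = d * (X * y + Y * x) ^ 2 + 1.
Proof.
move=> e e'; have : (X ^ 2) * (x ^ 2) = (d * Y ^ 2 + 1) * (d * y ^ 2 + 1) by rewrite e e'.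
have : d * Y ^ 2 * x ^ 2 = d * Y ^ 2 * (d * y ^ 2 + 1) by rewrite e'.
have : d * y ^ 2 * X ^ 2 = d * y ^ 2 * (d * Y ^ 2 + 1) by rewrite e.
by clear; lia.
Qed.

Lemma pell_powerP d X Y k : X ^ 2 = d * Y ^ 2 + 1 ->
  pellx d X Y k ^ 2 = d * pelly d X Y k ^ 2 + 1.
Proof.
move=> e; elim: k => [|k IH]; first by rewrite /pellx /pelly /= muln0.
by rewrite pellxS pellyS brahmagupta.
Qed.

Lemma pellx_gt0 d X Y k : X ^ 2 = d * Y ^ 2 + 1 -> 0 < pellx d X Y k.
Proof. by move/(pell_powerP d X Y k); rewrite addn1; case: pellx. Qed.

Lemma pell_gt1 d X Y : 0 < d -> 0 < Y -> X ^ 2 = d * Y ^ 2 + 1 -> 1 < X.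
Proof.
move=> d0 Y0 e; rewrite -(@ltn_exp2r _ _ 2) // e exp1n addn1 ltnS.
by rewrite muln_gt0 d0 expn_gt0 Y0.
Qed.

Lemma pellx_lt d X Y k : 0 < d -> 0 < Y -> X ^ 2 = d * Y ^ 2 + 1 ->
  pellx d X Y k < pellx d X Y k.+1.
Proof.
move=> d0 Y0 e; rewrite pellxS; have := pellx_gt0 d X Y k e.
move=> x0; apply: leq_trans (leq_addr _ _).
exact: (ltn_Pmull (pell_gt1 d X Y d0 Y0 e) x0).
Qed.

Lemma pellx_mono d X Y : 0 < d -> 0 < Y -> X ^ 2 = d * Y ^ 2 + 1 ->
  {mono pellx d X Y : j k / j <= k}.
Proof.
move=> d0 Y0 e; apply: leq_mono; apply: homo_ltn => [|k]; first exact: ltn_trans.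
exact: pellx_lt.
Qed.

(** Dividing a nontrivial solution by the least one lowers y: minimality gives
y >= Y, which makes the quotient nonnegative. *)
Lemma pell_descent d X Y x y : 0 < d -> minimal_solution d X Y ->
  0 < y -> x ^ 2 = d * y ^ 2 + 1 ->
  exists x' y', [/\ y' < y, x' ^ 2 = d * y' ^ 2 + 1,
    x = X * x' + d * Y * y' & y = X * y' + Y * x'].
Proof.
move=> d0 [Y0 e min] y0 e'; have leX := min _ _ y0 e'.
have leY : Y <= y.
  have : X ^ 2 <= x ^ 2 by rewrite leq_exp2r.
  by rewrite e e' leq_add2r leq_pmul2l // leq_exp2r.
have h1 : Y * x <= X * y.
  rewrite -(@leq_exp2r _ _ 2) // !expnMn e e'.
  have : Y ^ 2 <= y ^ 2 by rewrite leq_exp2r.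
  lia.
have h2 : d * Y * y < X * x.
  rewrite -(@ltn_exp2r _ _ 2) // !expnMn e e'; lia.
exists (X * x - d * Y * y), (X * y - Y * x).
have ex : X * x = d * Y * y + (X * x - d * Y * y) by lia.
have ey : X * y = Y * x + (X * y - Y * x) by lia.
move: (X * x - _) (X * y - _) ex ey => x' y' ex ey.
have Ex : x = X * x' + d * Y * y'.
  have : X * (X * x) = X * (d * Y * y + x') by rewrite ex.
  have : d * Y * (X * y) = d * Y * (Y * x + y') by rewrite ey.
  have : X ^ 2 * x = (d * Y ^ 2 + 1) * x by rewrite e.
  lia.
have Ey : y = X * y' + Y * x'.
  have : X * (X * y) = X * (Y * x + y') by rewrite ey.
  have : Y * (X * x) = Y * (d * Y * y + x') by rewrite ex.
  have : X ^ 2 * y = (d * Y ^ 2 + 1) * y by rewrite e.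
  lia.
have X0 := ltnW (pell_gt1 d X Y d0 Y0 e); have x'0 : 0 < x' by lia.
split => //.
  rewrite Ey -addn1 leq_add ?leq_pmull // muln_gt0; exact/andP.
have : x ^ 2 = d * y ^ 2 + 1 by [].
rewrite Ex Ey.
have : X ^ 2 * x' ^ 2 = (d * Y ^ 2 + 1) * x' ^ 2 by rewrite e.
have : d * y' ^ 2 * X ^ 2 = d * y' ^ 2 * (d * Y ^ 2 + 1) by rewrite e.
lia.
Qed.

Lemma pell_complete d X Y x y : 0 < d -> minimal_solution d X Y ->
  x ^ 2 = d * y ^ 2 + 1 -> exists k, x = pellx d X Y k /\ y = pelly d X Y k.
Proof.
move=> d0 mXY; elim/ltn_ind: y x => y IH x e.
case: (posnP y) => [y0|y0].
  by exists 0; split; rewrite // /pellx /=; move: e; rewrite y0 muln0 => /eqP; rewrite -[0 + 1]/(1 ^ 2) eqn_exp2r // => /eqP.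
have [x' [y' [lt e' Ex Ey]]] := pell_descent d X Y x y d0 mXY y0 e.
have [k [ex ey]] := IH _ lt _ e'.
by exists k.+1; rewrite pellxS pellyS -ex -ey.
Qed.

(** The indices of the solutions are those of the powers of the least solution,
which increase strictly. *)
Lemma sum_solutions d X Y n r : 0 < d -> minimal_solution d X Y ->
  pellx d X Y r < n -> n <= pellx d X Y r.+1 ->
  \sum_(i < n * n | is_sol d n i) i =
  (\sum_(k < r.+1) pellx d X Y k) * n + \sum_(k < r.+1) pelly d X Y k.
Proof.
move=> d0 mXY lo hi; have [Y0 e _] := mXY.
pose idx k := pellx d X Y k * n + pelly d X Y k.
have ylt k : k <= r -> pelly d X Y k < n.
  move=> kr; apply: leq_ltn_trans lo.
  rewrite -(pellx_mono d X Y d0 Y0 e) in kr; apply: leq_trans kr.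
  by rewrite -(@leq_exp2r _ _ 2) // (pell_powerP d X Y k e) (leq_trans (leq_pmull _ d0)) ?leq_addr.
have n0 : 0 < n by apply: leq_ltn_trans lo.
have idx_lt k : k <= r -> idx k < n * n.
  move=> kr; rewrite /idx -ltn_divLR // divnMDl // divn_small ?ylt // addn0.
  by apply: leq_ltn_trans lo; rewrite (pellx_mono d X Y d0 Y0 e).
have idx_inj k : k <= r -> (idx k %/ n = pellx d X Y k) * (idx k %% n = pelly d X Y k).
  move=> kr; rewrite /idx divnMDl // divn_small ?ylt // addn0.
  by rewrite modnMDl modn_small ?ylt.
rewrite -(big_mkord (is_sol d n) (fun i => i)) -big_filter.
transitivity (\sum_(i <- [seq idx k | k <- iota 0 r.+1]) i); last first.
  rewrite big_map -[iota 0 r.+1]/(index_iota 0 r.+1) big_mkord big_split /=.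
  by rewrite -big_distrl.
apply: perm_big; apply: uniq_perm.
- by rewrite filter_uniq ?iota_uniq.
- rewrite map_inj_in_uniq ?iota_uniq // => j k; rewrite !mem_iota !add0n !ltnS /=.
  move=> jr kr /(congr1 (divn^~ n)); rewrite !idx_inj //.
  exact: (incn_inj (pellx_mono d X Y d0 Y0 e)).
move=> i; rewrite mem_filter mem_index_iota leq0n; apply/idP/mapP.
- case/andP=> /eqP /(pell_complete d X Y _ _ d0 mXY)[k [ex ey]] i_lt.
  exists k; last by rewrite /idx -ex -ey -divn_eq.
  rewrite mem_iota /= add0n ltnNge; apply/negP => rk.
  have : pellx d X Y k < n by rewrite -ex ltn_divLR.
  by rewrite ltnNge (leq_trans hi) // (pellx_mono d X Y d0 Y0 e).
case=> k; rewrite mem_iota /= add0n ltnS => kr ->.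
by rewrite /is_sol !idx_inj // pell_powerP // eqxx idx_lt.
Qed.

(** This is what allows n to separate the sum of the y from that of the x. *)
Lemma sum_pelly_le d X Y r : 1 < d -> minimal_solution d X Y ->
  \sum_(k < r.+1) pelly d X Y k <= pellx d X Y r.
Proof.
move=> d1 [Y0 e _]; have d0 := ltnW d1.
have YX : Y < X.
  by rewrite -(@ltn_exp2r _ _ 2) // e addn1 ltnS leq_pmull.
have XdY : X <= d * Y.
  rewrite -(@leq_exp2r _ _ 2) // e expnMn.
  have dY0 : 0 < d * Y ^ 2 by rewrite muln_gt0 d0 expn_gt0 Y0.
  have : d * Y ^ 2 * 2 <= d * Y ^ 2 * d by rewrite leq_mul2l d1 orbT.
  lia.
elim: r => [|r IH]; first by rewrite big_ord_recl big_ord0.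
rewrite big_ord_recr /= pellyS pellxS.
have h1 : pellx d X Y r + Y * pellx d X Y r <= X * pellx d X Y r.
  by rewrite -mulSn leq_mul2r YX orbT.
have h2 : X * pelly d X Y r <= d * Y * pelly d X Y r by rewrite leq_mul2r XdY orbT.
move: IH h1 h2; move: (\sum_(_ < _) _) (pellx _ _ _ _) (pelly _ _ _ _) => S x y.
lia.
Qed.

(** Write e = X + Y sqrt d, and let E be the sum of the powers of e up to
P = e^r and E' its conjugate.  The first two equations are E = P E', the next two
e (E' - 1) = E' - 1/P, and the last two e E + 1 = E + e P.  The last pair is there
for the induction. *)
Lemma pell_sums d X Y r (sx := \sum_(k < r.+1) pellx d X Y k)
    (sy := \sum_(k < r.+1) pelly d X Y k) (a := pellx d X Y r) (b := pelly d X Y r) :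
  X ^ 2 = d * Y ^ 2 + 1 ->
  [/\ a * sx = sx + d * b * sy, b * sx = sy + a * sy,
      X * sx + a = sx + d * Y * sy + X, Y * sx + sy = X * sy + Y + b &
      X * sx + d * Y * sy + 1 = sx + X * a + d * Y * b /\
      X * sy + Y * sx = sy + X * b + Y * a].
Proof.
rewrite /sx /sy /a /b => e {sx sy a b}; elim: r => [|r].
  by rewrite !big_ord_recl !big_ord0 /pellx /pelly /=; split; lia.
have sS (F : nat -> nat) : \sum_(k < r.+2) F k = \sum_(k < r.+1) F k + F r.+1.
  by rewrite big_ord_recr.
have sol := pell_powerP d X Y r.+1 e; move: sol.
rewrite !sS !pellxS !pellyS.
move: (\sum_(_ < _) pellx _ _ _ _) (\sum_(_ < _) pelly _ _ _ _) (pellx _ _ _ _) (pelly _ _ _ _).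
move=> sx sy a b e' [h1 h2 h3 h4 [h5 h6]].
have ea : X ^ 2 * a = (d * Y ^ 2 + 1) * a by rewrite e.
have eb : X ^ 2 * b = (d * Y ^ 2 + 1) * b by rewrite e.
have k1 : X * (a * sx) = X * (sx + d * b * sy) by rewrite h1.
have k2 : d * Y * (b * sx) = d * Y * (sy + a * sy) by rewrite h2.
have k3 : X * (b * sx) = X * (sy + a * sy) by rewrite h2.
have k4 : Y * (a * sx) = Y * (sx + d * b * sy) by rewrite h1.
split.
- by move: k1 k2 h5 e'; clear; lia.
- by move: k3 k4 h6; clear; lia.
- by move: h3 ea; clear; lia.
- by move: h4 eb; clear; lia.
by split; [move: h5|move: h6]; clear; lia.
Qed.

(** In the notation of the previous lemma, e (N - E) = N - E' for N = E E', so with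
v = N - sx the ratio of Y to X + 1 is that of sy to v.  Together with
X^2 - 1 = d Y^2 this determines X and Y, with the denominator h. *)
Lemma pell_recover d X Y r (sx := \sum_(k < r.+1) pellx d X Y k)
    (sy := \sum_(k < r.+1) pelly d X Y k) (v := sx ^ 2 - d * sy ^ 2 - sx)
    (h := v ^ 2 - d * sy ^ 2) :
  0 < d -> 0 < Y -> 0 < r -> X ^ 2 = d * Y ^ 2 + 1 ->
  [/\ 0 < h, (v ^ 2 + d * sy ^ 2) %/ h = X & (v * sy * 2) %/ h = Y].
Proof.
move=> d0 Y0 r0 e; have X1 := pell_gt1 d X Y d0 Y0 e.
have sy0 : 0 < sy.
  rewrite /sy -(prednK r0) big_ord_recl big_ord_recl /= ltn_addl // ltn_addr //.
  by rewrite /pelly /= muln0 muln1.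
have [h1 h2 h3 h4 _] := pell_sums d X Y r e.
rewrite -/sx -/sy in h1 h2 h3 h4.
move: (pellx _ _ _ _) (pelly _ _ _ _) h1 h2 h3 h4 => a b h1 h2 h3 h4.
have k1 : sx * (X * sx + a) = sx * (sx + d * Y * sy + X) by rewrite h3.
have k2 : d * sy * (Y * sx + sy) = d * sy * (X * sy + Y + b) by rewrite h4.
have k3 : sx * (Y * sx + sy) = sx * (X * sy + Y + b) by rewrite h4.
have k4 : sy * (X * sx + a) = sy * (sx + d * Y * sy + X) by rewrite h3.
have r1 : Y * sx ^ 2 = Y * (d * sy ^ 2 + sx) + (X + 1) * sy by lia.
have r2 : X * sx ^ 2 + d * sy ^ 2 + sx = sx ^ 2 + X * (d * sy ^ 2 + sx) + d * Y * sy by lia.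
have v_def : sx ^ 2 = d * sy ^ 2 + sx + v.
  suff : d * sy ^ 2 + sx <= sx ^ 2 by rewrite /v; lia.
  by rewrite -(leq_pmul2l Y0) r1 leq_addr.
have r1' : Y * v = (X + 1) * sy by rewrite v_def in r1; lia.
have r2' : X * v = v + d * Y * sy by rewrite v_def in r2; lia.
have hX : X * v ^ 2 = v ^ 2 + d * sy ^ 2 + X * (d * sy ^ 2).
  have : v * (X * v) = v * (v + d * Y * sy) by rewrite r2'.
  have : d * sy * (Y * v) = d * sy * ((X + 1) * sy) by rewrite r1'.
  lia.
have hY : Y * v ^ 2 = v * sy * 2 + Y * (d * sy ^ 2).
  have : v * (Y * v) = v * ((X + 1) * sy) by rewrite r1'.
  have : sy * (X * v) = sy * (v + d * Y * sy) by rewrite r2'.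
  lia.
have h_def : v ^ 2 = d * sy ^ 2 + h.
  suff : d * sy ^ 2 <= v ^ 2 by rewrite /h; lia.
  by rewrite -(leq_pmul2l (ltnW X1)) hX leq_addl.
have hX' : X * h = v ^ 2 + d * sy ^ 2 by rewrite h_def in hX *; lia.
have hY' : Y * h = v * sy * 2 by rewrite h_def in hY *; lia.
have h0 : 0 < h.
  have : 0 < X * h by rewrite hX' addn_gt0 orbC muln_gt0 d0 expn_gt0 sy0.
  by rewrite muln_gt0 => /andP[].
by rewrite -hX' -hY' !mulnK.
Qed.

(** * Closed forms for the search *)

Lemma cube_lt_exp2 n : 10 <= n -> n ^ 3 + 1 < 2 ^ n.
Proof.
elim: n => // n IH; rewrite leq_eqVlt => /orP[/eqP <- //|]; rewrite ltnS => h.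
have := IH h; rewrite (expnS 2).
have : 10 * n ^ 2 <= n * n ^ 2 by rewrite leq_mul2r h orbT.
have : 10 * n <= n * n by rewrite leq_mul2r h orbT.
move: (2 ^ n) => T; lia.
Qed.

(** L, the common step of the weights.  It has to exceed n^2 (n + 1), the total
error of n^2 valuations. *)
Definition weight_step (n : nat) : nat := n ^ 4.

(** A shift by one weight step. *)
Definition weight_base (n : nat) : nat := 2 ^ weight_step n.

(** 2^(n^8), wide enough for the largest weight, about n^6 bits. *)
Definition digit_base (n : nat) : nat := weight_base n ^ weight_step n.
Definition row_base (n : nat) : nat := digit_base n ^ n.

(** 2^(n^10), the base digit_base n raised to the number n^2 of digits.  As a
power of 2 beyond every possible valuation it also serves as the modulus. *)
Definition table_size (n : nat) : nat := row_base n ^ n.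

Section Search.

Variable n : nat.
Hypothesis n16 : 16 <= n.

Local Notation L := (weight_step n).
Local Notation lam := (weight_base n).
Local Notation Q := (digit_base n).
Local Notation p := (row_base n).
Local Notation M := (table_size n).

Lemma search_QE : Q = 2 ^ n ^ 8.
Proof. by rewrite /digit_base /weight_base -expnM /weight_step -expnD. Qed.

Lemma search_ME : M = Q ^ (n * n).
Proof. by rewrite /table_size /row_base -expnM. Qed.

Lemma search_M2 : M = 2 ^ n ^ 10.
Proof. by rewrite search_ME search_QE -expnM mulnn -expnD. Qed.

Lemma search_room : n + L * (n * n) + 2 < n ^ 8.
Proof.
have n0 : 0 < n by lia.
have : n ^ 6 * 256 <= n ^ 6 * (n * n) by rewrite leq_mul2l (@leq_mul 16 16) ?orbT.
have : n ^ 1 <= n ^ 6 by rewrite leq_pexp2l.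
rewrite /weight_step; lia.
Qed.

Lemma search_errors_lt : n * n * (n + 1) < L.
Proof.
have : n ^ 3 * 16 <= n ^ 3 * n by rewrite leq_mul2l n16 orbT.
have : n ^ 2 * 16 <= n ^ 2 * n by rewrite leq_mul2l n16 orbT.
have : 0 < n ^ 2 by rewrite expn_gt0; lia.
rewrite /weight_step; lia.
Qed.

Lemma search_weight_lt K : K <= n * n * (L * (n * n) + n + 1) -> K < n ^ 10.
Proof.
have n0 : 0 < n by lia.
move/leq_ltn_trans; apply; have := search_room.
have : n * n * (n + L * (n * n) + 2) <= n * n * n ^ 8 by rewrite leq_mul2l ltnW ?search_room ?orbT.
have : 0 < n * n by rewrite muln_gt0 n0.
lia.
Qed.

Lemma search_weight_lt2 K : K < n ^ 10 -> K.+1 < 2 ^ L.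
Proof.
have n0 : 0 < n by lia.
have cube : n ^ 3 < 2 ^ n by apply: leq_ltn_trans (leq_addr 1 _) (cube_lt_exp2 _ _); lia.
move/leq_ltn_trans; apply; apply: (@leq_ltn_trans (n ^ (3 * 4))); first by rewrite leq_pexp2l.
rewrite expnM; apply: (@leq_trans (2 ^ (n * 4))); first by rewrite (expnM 2) ltn_exp2r.
rewrite leq_exp2l // /weight_step (expnS n 3) leq_mul2l (leq_trans (_ : 4 <= n ^ 1)) ?orbT ?leq_pexp2l //.
by rewrite expn1; lia.
Qed.

Lemma search_Qbig : n ^ 2 + 2 * n + 3 < Q.
Proof.
have h := cube_lt_exp2 n (leq_trans (isT : 10 <= 16) n16).
apply: (@ltn_trans (2 ^ n)); last by rewrite search_QE ltn_exp2l //; have := search_room; lia.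
have : 16 * n ^ 2 <= n * n ^ 2 by rewrite leq_mul2r n16 orbT.
have : 16 * n <= n * n by rewrite leq_mul2r n16 orbT.
lia.
Qed.

Lemma digit_base_gt2 : 2 < Q.
Proof. by apply: leq_ltn_trans search_Qbig; rewrite addn3. Qed.

Lemma row_base_ge : Q <= p.
Proof.
have n0 : 0 < n := leq_trans (isT : 0 < 16) n16.
exact: (@leq_pexp2l Q 1 n (ltnW (ltnW digit_base_gt2)) n0).
Qed.

Lemma table_size_ge : p <= M.
Proof.
have n0 : 0 < n := leq_trans (isT : 0 < 16) n16.
exact: (@leq_pexp2l p 1 n (ltnW (ltnW (leq_trans digit_base_gt2 row_base_ge))) n0).
Qed.

Lemma table_size_gt2 : 2 < M.
Proof. exact: leq_trans (leq_trans digit_base_gt2 row_base_ge) table_size_ge. Qed.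

Lemma weight_base_gt1 : 1 < lam.
Proof. by rewrite (leq_ltn_trans _ (ltn_expl _ _)) // expn_gt0 (leq_trans _ n16). Qed.

Lemma weight_base_lt : lam < Q.
Proof.
rewrite search_QE /weight_base ltn_exp2l // (leq_ltn_trans _ search_room) //.
rewrite -addnA (leq_trans _ (leq_addl _ _)) // (leq_trans _ (leq_addr _ _)) //.
by rewrite leq_pmulr // muln_gt0 (leq_trans _ n16).
Qed.

(** On the grid, x^2 and 1 have rational generating functions in base Q^n, and
d y^2 + 1 and 1 in base Q; the weight 2^(n + L i) is a geometric series. *)
Lemma search_digit_values (d : nat) : d <= n ->
  let be := p * (Q + 1) %/ (Q - 1) ^ 3 in
  let g := p %/ (Q - 1) in
  let al := M * (p + 1) %/ (p - 1) ^ 3 in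
  let ga := M %/ (p - 1) in
  let G' := M * 2 ^ n %/ (Q - lam) in
  al * g + G' - (d * be + g) * ga =
    digits Q (fun i => (i %/ n) ^ 2 + 2 ^ (n + L * i) - (d * (i %% n) ^ 2 + 1)) (n * n) /\
  G' - M %/ (Q - 1) = digits Q (fun i => 2 ^ (n + L * i) - 1) (n * n).
Proof.
move=> dn; have Qb := search_Qbig; have n0 : 0 < n by lia.
have pQ := row_base_ge; have Q2 := digit_base_gt2; have p2 := leq_trans Q2 pQ.
have room := search_room; move=> be g al ga G'.
have -> : be = digits Q (fun i => i ^ 2) n by rewrite /be /row_base divn_digits_sqr.
have -> : al = digits p (fun i => i ^ 2) n.
  by rewrite /al /table_size divn_digits_sqr // (leq_trans Qb).
have -> : g = digits Q (fun => 1) n by rewrite /g /row_base divn_digits_one.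
have -> : ga = digits p (fun => 1) n by rewrite /ga /table_size divn_digits_one.
have -> : G' = digits Q (fun i => 2 ^ (n + L * i)) (n * n).
  rewrite /G' search_ME divn_digits_geom.
    by apply: eq_digits => i _; rewrite expnD expnM.
  rewrite search_QE /weight_base -expnM -expnD.
  apply: (@leq_ltn_trans (2 ^ (n + L * (n * n)) * 2)).
    by rewrite muln2 -addnn leq_add2l leq_exp2l //; rewrite (leq_trans _ (leq_addl _ _)) // leq_pmulr // muln_gt0 n0.
  by rewrite -expnSr ltn_exp2l // (leq_ltn_trans _ room) // addn2 ltnW.
have -> : M %/ (Q - 1) = digits Q (fun => 1) (n * n) by rewrite search_ME divn_digits_one.
have xE : digits p (fun i => i ^ 2) n * digits Q (fun => 1) n = digits Q (fun i => (i %/ n) ^ 2) (n * n).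
  rewrite -(digits_pair Q (fun i => i ^ 2)); apply: eq_digits => i _; exact: muln1.
have yE : (d * digits Q (fun i => i ^ 2) n + digits Q (fun => 1) n) * digits p (fun => 1) n =
     digits Q (fun i => d * (i %% n) ^ 2 + 1) (n * n).
  rewrite mulnC -digitsZ -digitsD -(digits_pair Q (fun => 1) (fun i => d * i ^ 2 + 1)).
  by apply: eq_digits => i _; rewrite mul1n.
have yT i : d * (i %% n) ^ 2 + 1 <= 2 ^ (n + L * i).
  apply: leq_trans (leq_pexp2l _ (leq_addr (L * i) n)) => //.
  apply: leq_trans (ltnW (cube_lt_exp2 n (leq_trans _ n16))) => //.
  by rewrite leq_add2r (expnS n 2) leq_mul // leq_exp2r // ltnW // ltn_mod.
split.
  rewrite xE yE -digitsD; apply/eqP; rewrite -(eqn_add2r (digits Q (fun i => d * (i %% n) ^ 2 + 1) (n * n))).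
  rewrite subnK -?digitsD.
    by apply/eqP/eq_digits => i _; rewrite subnK // (leq_trans (yT i)) // leq_addl.
  by apply: leq_digits => i; rewrite (leq_trans (yT i)) ?leq_addl.
apply/eqP; rewrite -(eqn_add2r (digits Q (fun => 1) (n * n))) subnK -?digitsD.
  by apply/eqP/eq_digits => i _; rewrite subnK // expn_gt0.
by apply: leq_digits => i; rewrite expn_gt0.
Qed.

(** Reduction modulo table_size n keeps the power of 2 in the binomial
coefficient, since that power is smaller. *)
Lemma search_index (d : nat) : d <= n ->
  let m := n ^ 2 in
  let a := digits Q (fun i => (i %/ n) ^ 2 + 2 ^ (n + L * i) - (d * (i %% n) ^ 2 + 1)) (n * n) in
  let b := digits Q (fun i => 2 ^ (n + L * i) - 1) (n * n) in
  let N := a + b in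
  let r := (((2 ^ N + 1) ^ N %/ (2 ^ N) ^ a) %% 2 ^ N) %% M in
  let u := M ^ M in
  let g := ((u ^ r %/ (u - 1)) %% (M ^ r - 1)) %% M in
  let k := (g ^ L %% (lam - 1) ^ 2) %/ (lam - 1) in
  0 < r /\ m * (m - 1) %/ 2 - k %/ L = \sum_(i < n * n | is_sol d n i) i.
Proof.
move=> dn m a b N r u g k; have n0 : 0 < n by lia.
have room := search_room.
have cube := cube_lt_exp2 n (leq_trans (isT : 10 <= 16) n16).
have [hE hK] : m * (m - 1) %/ 2 - logn 2 'C(N, b) %/ L = \sum_(i < n * n | is_sol d n i) i /\
    logn 2 'C(N, b) <= n * n * (L * (n * n) + n + 1).
  rewrite /m -mulnn /N /a /b search_QE.
  apply: (search_count d n L (n ^ 8)) => //.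
  - exact: search_errors_lt.
  - by apply: leq_ltn_trans cube; rewrite leq_add2r (expnS n 2) leq_mul.
  - apply: leq_ltn_trans cube; rewrite (leq_trans _ (leq_addr _ _)) //.
    by rewrite leq_pexp2l.
have NE : 'C(N, b) = 'C(N, a) by rewrite -[RHS]bin_sub ?leq_addr // addKn.
have N0 : 0 < N.
  rewrite /N addn_gt0 /b -(@prednK (n * n)) ?muln_gt0 ?n0 // digitsS addn_gt0.
  rewrite subn_gt0 (leq_ltn_trans _ (ltn_expl _ _)) ?orbT // addn_gt0 n0 //.
have rE : r = 'C(N, a) %% M.
  rewrite /r (bin_digit (2 ^ N)) ?leq_addr //; last by move=> i; exact: bin_lt_exp2.
  by rewrite (modn_small (m := 'C(N, a))) ?bin_lt_exp2.
have [K eK] : exists K, logn 2 'C(N, b) = K by eexists.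
rewrite eK in hE hK.
have Klt := search_weight_lt K hK.
have gcdE : gcdn M r = 2 ^ K.
  rewrite rE gcdn_modr search_M2.
  have [o co eo] := @pfactor_coprime 2 'C(N, a) isT (etrans (bin_gt0 _ _) (leq_addr _ _)).
  rewrite eo -NE eK -(subnK (ltnW Klt)) expnD -muln_gcdl.
  by rewrite (eqP (_ : coprime _ _)) ?mul1n // coprimeXl.
have MK : 2 ^ K < M by rewrite search_M2 ltn_exp2l.
have r0 : 0 < r.
  by rewrite lt0n; apply: contraL MK => /eqP r_0; rewrite -gcdE r_0 gcdn0 ltnn.
split=> //; rewrite -hE; congr (_ - _ %/ L).
have M2 := table_size_gt2.
have gE : g = 2 ^ K.
  rewrite /g divn_geom; last first.
    by rewrite (leq_trans M2) // -{1}[M]expn1 leq_pexp2l // ltnW // ltnW.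
  by rewrite gcd_by_powers // gcdE.
rewrite /k gE log_by_powers //; first exact: search_weight_lt2.
by rewrite /weight_step -(exp1n 4) ltn_exp2r // (leq_trans _ n16).
Qed.

End Search.

(** * Square roots modulo n *)

(** The roots t with the same a are congruent modulo n / gcd(a, b), so one is
determined by its quotient there, a number below gcd(a, b).  Subtracting this
quotient from a, a multiple of gcd(a, b), loses nothing once gcd(a, b) is known,
and gcd(a, b) depends on b and d only. *)
Definition root_code (n D t : nat) : nat * nat :=
  let a := gcdn n (t + n - D) in
  let b := n %/ a in
  (b, a - t %/ (n %/ gcdn a b)).

(** From n | (t - D)(t + D), where a takes its full share of t - D. *)
Lemma root_split d n D t : 0 < n -> D < n ->
  D ^ 2 = d %[mod n] -> t ^ 2 = d %[mod n] ->
  let a := gcdn n (t + n - D) in let b := n %/ a in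
  exists s, [/\ 0 < a, n = a * b, t + n = a * s + D, coprime b s & b %| a * s + 2 * D].
Proof.
move=> n0 Dn eD et a b.
have a0 : 0 < a by rewrite gcdn_gt0 n0.
have en : n = a * b by rewrite mulnC divnK // dvdn_gcdl.
pose s := (t + n - D) %/ a.
have es : t + n - D = a * s by rewrite mulnC divnK // dvdn_gcdr.
have ets : t + n = a * s + D by rewrite -es subnK // (leq_trans (ltnW Dn)) // leq_addl.
have cop : coprime b s.
  by rewrite /coprime -(eqn_pmul2l a0) muln1 muln_gcdr -en -es.
exists s; split=> //.
rewrite -(Gauss_dvdr _ cop) -(dvdn_pmul2l a0) -en mulnA.
have : (t + n) ^ 2 = D ^ 2 %[mod n] by rewrite -modnXm modnDr modnXm et -eD.
rewrite ets => /eqP; rewrite eqn_mod_dvd; last by rewrite leq_exp2r // leq_addl.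
by rewrite subn_sqr addnK -addnA addnn -mul2n.
Qed.

(** With g = gcd(a, b), coprimality of b and s turns b | a s + 2 D into
g = gcd(2 D, b).  Since 4 D^2 = 4 d modulo a b, and g^2 | a b, the square of g
is the gcd of 4 d and b^2. *)
Lemma root_gcd d n D t : 0 < n -> D < n ->
  D ^ 2 = d %[mod n] -> t ^ 2 = d %[mod n] ->
  let a := gcdn n (t + n - D) in let b := n %/ a in
  gcdn (4 * d) (b ^ 2) = gcdn a b ^ 2.
Proof.
move=> n0 Dn eD et a b; have [s [a0 en ets cop dv]] := root_split d n D t n0 Dn eD et.
rewrite -/a -/b in a0 en ets cop dv; clearbody b; clearbody a.
have b0 : 0 < b by move: n0; rewrite en muln_gt0 a0.
set g := gcdn a b; have g0 : 0 < g by rewrite gcdn_gt0 a0.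
have g2D : gcdn (2 * D) b = g.
  apply/eqP; rewrite eqn_dvd !dvdn_gcd dvdn_gcdr dvdn_gcdr !andbT; apply/andP; split.
    have h : gcdn (2 * D) b %| a * s.
      rewrite -(@dvdn_addl (2 * D)) ?dvdn_gcdl //.
      exact: dvdn_trans (dvdn_gcdr _ _) dv.
    rewrite -(@Gauss_dvdl _ _ s) //.
    exact: coprime_dvdl (dvdn_gcdr _ _) cop.
  rewrite -(@dvdn_addr (a * s)); last by rewrite dvdn_mulr ?dvdn_gcdl.
  exact: dvdn_trans (dvdn_gcdr _ _) dv.
have [a' ea] := dvdnP (dvdn_gcdl a b); have [b' eb] := dvdnP (dvdn_gcdr a b).
have [D' eD'] : exists D', 2 * D = D' * g by apply/dvdnP; rewrite -g2D dvdn_gcdl.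
rewrite -/g in ea eb.
have copD : coprime D' b'.
  by rewrite /coprime -(eqn_pmul2r g0) mul1n muln_gcdl -eD' -eb g2D.
have nE : n = a' * b' * g ^ 2 by rewrite en ea eb mulnACA.
have dvg : g ^ 2 %| n by rewrite nE dvdn_mull.
have e4 : 4 * d = D' ^ 2 * g ^ 2 %[mod n].
  by rewrite -expnMn -eD' expnMn -[RHS]modnMmr eD modnMmr.
have [d' ed'] : exists d', 4 * d = d' * g ^ 2.
  apply/dvdnP; rewrite /dvdn -(modn_dvdm _ dvg) e4 modn_dvdm //.
  by rewrite modnMl.
have copd : coprime d' b'.
  have e5 : d' = D' ^ 2 %[mod b'].
    have : d' * g ^ 2 = D' ^ 2 * g ^ 2 %[mod a' * b' * g ^ 2] by rewrite -nE -ed' e4.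
    rewrite -!muln_modl => /eqP; rewrite eqn_pmul2r ?expn_gt0 ?g0 // => /eqP e6.
    by rewrite -(modn_dvdm d' (dvdn_mull a' (dvdnn b'))) e6 modn_dvdm // dvdn_mull.
  by rewrite -coprime_modl e5 coprime_modl coprimeXl.
rewrite ed' {1}eb expnMn -muln_gcdl.
have /eqP -> : coprime d' (b' ^ 2) by rewrite coprimeXr.
by rewrite mul1n.
Qed.

Lemma root_code_bounds d n D t : 0 < n -> D < n -> t < n ->
  D ^ 2 = d %[mod n] -> t ^ 2 = d %[mod n] ->
  [/\ 0 < (root_code n D t).1, 0 < (root_code n D t).2 &
      (root_code n D t).1 * (root_code n D t).2 <= n].
Proof.
move=> n0 Dn tn eD et; have [s [a0 en ets cop dv]] := root_split d n D t n0 Dn eD et.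
rewrite /root_code /=; move: (gcdn n _) a0 en {ets cop dv} => a a0.
move: (n %/ a) => b en.
have b0 : 0 < b by move: n0; rewrite en muln_gt0 a0.
split=> //; last by rewrite mulnC en leq_mul2r leq_subr orbT.
have g0 : 0 < gcdn a b by rewrite gcdn_gt0 a0.
rewrite subn_gt0 (@leq_trans (gcdn a b)) //; last by rewrite dvdn_leq ?dvdn_gcdl.
rewrite ltn_divLR; last by rewrite divn_gt0 // dvdn_leq // en dvdn_mulr ?dvdn_gcdl.
by rewrite mulnC divnK // en dvdn_mulr ?dvdn_gcdl.
Qed.

Lemma subn_cross a b x y : x <= a -> y <= b -> a - x = b - y -> a + y = b + x.
Proof. lia. Qed.

(** Equal b give equal g, and a is the least multiple of g not below the
second component.  Hence n = a b agrees, and then t modulo n / g and its quotient. *)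
Lemma root_code_inj d n D t n' D' t' : 0 < n -> D < n -> t < n -> 0 < n' -> D' < n' -> t' < n' ->
  D ^ 2 = d %[mod n] -> t ^ 2 = d %[mod n] ->
  D' ^ 2 = d %[mod n'] -> t' ^ 2 = d %[mod n'] -> (n = n' -> D = D') ->
  root_code n D t = root_code n' D' t' -> n = n' /\ t = t'.
Proof.
move=> n0 Dn tn n0' Dn' tn' eD et eD' et' DD.
have := root_gcd d n D t n0 Dn eD et; have := root_gcd d n' D' t' n0' Dn' eD' et'.
have [s [a0 en ets cop dv]] := root_split d n D t n0 Dn eD et.
have [s' [a0' en' ets' cop' dv']] := root_split d n' D' t' n0' Dn' eD' et'.
rewrite /root_code /=.
move: (gcdn n _) a0 en ets cop dv => a a0; move: (n %/ a) => b en ets cop dv.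
move: (gcdn n' _) a0' en' ets' cop' dv' => a' a0'; move: (n' %/ a') => b' en' ets' cop' dv'.
move=> gE' gE [eb]; rewrite -eb in en' ets' cop' dv' gE' *.
have b0 : 0 < b by move: n0; rewrite en muln_gt0 a0.
have gg : gcdn a b = gcdn a' b.
  by apply/eqP; rewrite -(@eqn_exp2r _ _ 2) // -gE -gE'.
rewrite -gg; set g := gcdn a b; have g0 : 0 < g by rewrite gcdn_gt0 a0.
have ga : g %| a by rewrite dvdn_gcdl.
have ga' : g %| a' by rewrite /g gg dvdn_gcdl.
have q_lt : t %/ (n %/ g) < g.
  rewrite ltn_divLR; last by rewrite divn_gt0 // dvdn_leq // en dvdn_mulr.
  by rewrite mulnC divnK // en dvdn_mulr.
have q_lt' : t' %/ (n' %/ g) < g.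
  rewrite ltn_divLR; last by rewrite divn_gt0 // dvdn_leq // en' dvdn_mulr.
  by rewrite mulnC divnK // en' dvdn_mulr.
move=> ev.
have aa : a = a'.
  have le1 : t %/ (n %/ g) <= a by exact: leq_trans (ltnW q_lt) (dvdn_leq a0 ga).
  have le2 : t' %/ (n' %/ g) <= a' by exact: leq_trans (ltnW q_lt') (dvdn_leq a0' ga').
  have e1 : a + t' %/ (n' %/ g) = a' + t %/ (n %/ g) by exact: subn_cross.
  have e2 : t' %/ (n' %/ g) = t %/ (n %/ g).
    rewrite -(modn_small q_lt) -(modn_small q_lt').
    have := congr1 (modn^~ g) e1.
    by rewrite -modnDml (eqP ga) add0n -[in RHS]modnDml (eqP ga') add0n.
  by move: e1; rewrite e2 => /addIn.
have nn : n = n' by rewrite en en' aa.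
split=> //; rewrite -aa in en' ets' cop' dv' ev.
have DD' := DD nn; rewrite -DD' -nn in ets' dv' ev tn'.
have qq : t %/ (n %/ g) = t' %/ (n %/ g).
  have le1 : t %/ (n %/ g) <= a by exact: leq_trans (ltnW q_lt) (dvdn_leq a0 ga).
  have le2 : t' %/ (n %/ g) <= a by rewrite nn; exact: leq_trans (ltnW q_lt') (dvdn_leq a0 ga).
  by have := subn_cross _ _ _ _ le1 le2 ev => /addnI ->.
suff tt : t = t' %[mod n %/ g] by rewrite (divn_eq t (n %/ g)) (divn_eq t' (n %/ g)) qq tt.
clear - en ets ets' dv dv' g0 ga a0.
wlog le : s s' t t' ets ets' dv dv' / s <= s'.
  by move=> W; case/orP: (leq_total s s') => h; [|symmetry]; apply: W h => //.
have tt : t <= t' by rewrite -(leq_add2r n) ets ets' leq_add2r leq_mul2l le orbT.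
symmetry; apply/eqP; rewrite eqn_mod_dvd // -(subnDr n) ets ets' subnDr -mulnBr.
have dvs : b %| a * (s' - s).
  by rewrite mulnBr -(subnDr (2 * D)) dvdn_sub.
have -> : n %/ g = a * (b %/ g) by rewrite en muln_divA // dvdn_gcdr.
rewrite dvdn_pmul2l //; have gb : g %| b by rewrite dvdn_gcdr.
have [b1 eb] := dvdnP gb; have [a1 ea] := dvdnP ga.
have cop : coprime b1 a1.
  by rewrite coprime_sym /coprime -(eqn_pmul2r g0) mul1n muln_gcdl -ea -eb.
by rewrite eb mulnK // -(Gauss_dvdr _ cop) -(dvdn_pmul2r g0) -eb mulnAC -ea.
Qed.

(** * Counting classes of small norm *)

Lemma pigeonhole (T : eqType) (f : nat -> T) (s : seq T) k :
  (forall i, i < k -> f i \in s) -> size s < k ->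
  exists i j, [/\ i < j, j < k & f i = f j].
Proof.
move=> fs sk.
have : ~~ uniq [seq f i | i <- iota 0 k].
  apply: contraL sk => us; rewrite -leqNgt -[k](size_iota 0) -(size_map f).
  apply: uniq_leq_size us _ => x /mapP[i]; rewrite mem_iota => ik ->; exact: fs.
case/(uniqPn (f 0)) => i [j [ij]]; rewrite size_map size_iota => jk.
rewrite !(nth_map 0) ?size_iota ?(ltn_trans ij) // !nth_iota ?(ltn_trans ij) //.
by exists i, j.
Qed.

(** Each dyadic block of b contributes at most n. *)
Lemma sum_divn_harmonic n k : \sum_(1 <= b < 2 ^ k) n %/ b <= k * n.
Proof.
elim: k => [|k IH]; first by rewrite big_geq.
have le : 2 ^ k <= 2 ^ k.+1 by rewrite leq_exp2l.
rewrite (big_cat_nat (n := 2 ^ k)) ?expn_gt0 //= mulSn addnC leq_add //.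
apply: (@leq_trans (\sum_(2 ^ k <= b < 2 ^ k.+1) n %/ 2 ^ k)).
  by rewrite big_nat [X in _ <= X]big_nat; apply: leq_sum => b /andP[h _]; rewrite leq_div2l // expn_gt0.
rewrite sum_nat_const_nat expnS mul2n -addnn addnK mulnC; exact: leq_divM.
Qed.

Lemma sum_divn_pow2 n k : \sum_(r < k) n %/ 2 ^ r <= 2 * n.
Proof.
elim: k n => [|k IH] n; first by rewrite big_ord0.
rewrite big_ord_recl divn1 mul2n -addnn leq_add2l.
under eq_bigr do rewrite /= /bump leq0n add1n expnS divnMA.
by apply: leq_trans (IH _) _; rewrite mulnC leq_divM.
Qed.

Definition code_pairs (n : nat) : seq (nat * nat) :=
  [seq (b, v) | b <- iota 1 n, v <- iota 1 (n %/ b)].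

Lemma mem_code_pairs n b v : 0 < b -> 0 < v -> b * v <= n -> (b, v) \in code_pairs n.
Proof.
move=> b0 v0 bv; apply: allpairs_f_dep; rewrite mem_iota add1n ltnS ?b0 ?v0 /=.
  by apply: leq_trans bv; rewrite leq_pmulr.
by rewrite leq_divRL // mulnC.
Qed.

Lemma size_code_pairs n : size (code_pairs n) <= (trunc_log 2 n).+1 * n.
Proof.
apply: leq_trans (sum_divn_harmonic n (trunc_log 2 n).+1).
have h := @trunc_log_ltn 2 n isT.
rewrite size_allpairs_dep sumnE big_map (eq_bigr (fun b => n %/ b)) => [|b _]; last first.
  by rewrite size_iota.
have -> : iota 1 n = index_iota 1 n.+1 by rewrite /index_iota subSS subn0.
rewrite [X in _ <= X](big_cat_nat (n := n.+1)) //=; exact: leq_addr.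
Qed.

Definition codes (n : nat) : seq (nat * (nat * nat)) :=
  [seq (r, x) | r <- iota 0 (trunc_log 2 n).+1, x <- code_pairs (n %/ 2 ^ r)].

Lemma mem_codes n r b v : 0 < b -> 0 < v -> 2 ^ r * (b * v) <= n ->
  (r, (b, v)) \in codes n.
Proof.
move=> b0 v0 le; apply: allpairs_f_dep; last first.
  by rewrite mem_code_pairs // leq_divRL ?expn_gt0 // mulnC.
rewrite mem_iota /= add0n ltnS trunc_log_max // (leq_trans _ le) //.
by rewrite leq_pmulr // muln_gt0 b0.
Qed.

Lemma size_codes n : size (codes n) <= 2 * n * (trunc_log 2 n).+1.
Proof.
rewrite size_allpairs_dep sumnE big_map -[(trunc_log 2 n).+1]subn0.
rewrite -/(index_iota _ _) big_mkord subn0.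
apply: (@leq_trans (\sum_(r < (trunc_log 2 n).+1) (trunc_log 2 n).+1 * (n %/ 2 ^ r))).
  apply: leq_sum => r _; apply: leq_trans (size_code_pairs _) _.
  by rewrite leq_mul2r ltnS leq_trunc_log ?orbT // leq_div.
by rewrite -big_distrr /= mulnC leq_mul2r sum_divn_pow2 orbT.
Qed.

(** * A bound for the least solution *)

Lemma modn_eqZ (m k n : nat) : m = k %[mod n] -> exists a : int, (m%:Z = k%:Z + n%:Z * a)%R.
Proof.
move=> e; exists ((m %/ n)%:Z - (k %/ n)%:Z)%R.
rewrite {1}(divn_eq m n) {1}(divn_eq k n) e !PoszD !PoszM; ring.
Qed.

(** Up to sign, the quotient of p + q sqrt d by p' + q' sqrt d has the numerators
p p' - d q q' and p q' - p' q over n.  Both are divisible by n because p / q and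
p' / q' agree modulo n and square to d there. *)
Lemma norm_quotient (d n t p q p' q' : nat) :
  0 < n -> 0 < q' -> 0 < p -> coprime p q -> coprime p' q' -> (p, q) != (p', q') ->
  ((p%:Z ^+ 2 - d%:Z * q%:Z ^+ 2) * (p'%:Z ^+ 2 - d%:Z * q'%:Z ^+ 2) = n%:Z ^+ 2)%R ->
  t ^ 2 = d %[mod n] -> p = t * q %[mod n] -> p' = t * q' %[mod n] ->
  exists X Y, [/\ 0 < Y, X ^ 2 = d * Y ^ 2 + 1 & X <= p * p' + d * q * q'].
Proof.
move=> n0 q'0 p0 cop cop' neq nn et ep ep'.
have [c ec] := modn_eqZ _ _ _ (esym et).
have [a ea] := modn_eqZ _ _ _ ep; have [a' ea'] := modn_eqZ _ _ _ ep'.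
rewrite !PoszM in ea ea'; rewrite -mulnn PoszM in ec.
pose X : int := (a * t%:Z * q'%:Z + a' * t%:Z * q%:Z + n%:Z * a * a' - c * q%:Z * q'%:Z)%R.
pose Y : int := (a * q'%:Z - a' * q%:Z)%R.
have eX : (p%:Z * p'%:Z - d%:Z * q%:Z * q'%:Z = n%:Z * X)%R.
  by rewrite ea ea' ec /X; ring.
have eY : (p%:Z * q'%:Z - p'%:Z * q%:Z = n%:Z * Y)%R.
  by rewrite ea ea' /Y; ring.
have n0Z : (n%:Z != 0 :> int)%R by rewrite -lt0n.
have XY : (X ^+ 2 = d%:Z * Y ^+ 2 + 1)%R.
  apply: (mulfI (expf_neq0 2 n0Z)).
  rewrite -exprMn -eX mulrDr mulrCA -exprMn -eY mulr1 -nn; ring.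
have Y0 : (Y != 0)%R.
  apply: contraNneq neq => Y0; move: eY; rewrite Y0 mulr0 => /eqP.
  rewrite subr_eq0 -!PoszM eqz_nat => /eqP e.
  have pp' : p = p'.
    apply/eqP; rewrite eqn_dvd -(Gauss_dvdl _ cop) -e dvdn_mulr //=.
    by rewrite -(Gauss_dvdl _ cop') e dvdn_mulr.
  by rewrite xpair_eqE pp' eqxx /= -(eqn_pmul2l p0) e pp' eqxx.
exists `|X|%N, `|Y|%N; split; first by rewrite lt0n absz_eq0.
  have sqE (Z : int) : ((`|Z| ^ 2)%N%:Z = Z ^+ 2)%R.
    by rewrite -abszX gez0_abs // sqr_ge0.
  by apply/eqP; rewrite -eqz_nat PoszD PoszM !sqE XY.
have : (`|n%:Z * X| <= p%:Z * p'%:Z + d%:Z * q%:Z * q'%:Z)%R.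
  rewrite -eX (le_trans (ler_normB _ _)) // !ger0_norm // ?mulr_ge0 //.
rewrite -abszE -!PoszM -PoszD lez_nat abszM absz_nat.
by apply: leq_trans; rewrite leq_pmull.
Qed.

(** Dirichlet's theorem for the scale 2^j, with the common factor removed. *)
Lemma dirichlet (R : realType) (w : R) (j : nat) : (1 <= w)%R ->
  exists p q, [/\ 0 < p, 0 < q, q <= 2 ^ j, coprime p q &
    (`|p%:R - q%:R * w| * (2 ^ j)%:R < 1)%R].
Proof.
move=> w1; set T := 2 ^ j; have T0 : 0 < T by rewrite expn_gt0.
have w0 : (0 <= w)%R by apply: le_trans w1.
pose A q := Num.truncn (T%:R * (q%:R * w))%R.
have AP q : ((A q)%:R <= T%:R * (q%:R * w) < (A q).+1%:R)%R.
  by apply: truncn_itv; rewrite !mulr_ge0.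
have [||q1 [q2 [lt_q lt_T eA]]] := pigeonhole _ (fun q => A q %% T) (iota 0 T) T.+1 _ _.
- by move=> i _; rewrite mem_iota add0n ltn_mod.
- by rewrite size_iota.
have leA : A q1 <= A q2.
  apply: le_truncn; rewrite ler_wpM2l // ler_wpM2r // ler_nat; exact: ltnW.
have [p0 ep0] : exists p0, A q2 = A q1 + T * p0.
  have : T %| A q2 - A q1 by rewrite -eqn_mod_dvd // eq_sym; apply/eqP.
  by case/dvdnP=> p0 e; exists p0; rewrite mulnC -e subnKC.
pose q0 := q2 - q1; have q0_gt0 : 0 < q0 by rewrite subn_gt0.
have close : (`|p0%:R - q0%:R * w| * T%:R < 1)%R.
  have TR : (0 < T%:R :> R)%R by rewrite ltr0n.
  rewrite -[X in (_ * X)%R]gtr0_norm // -normrM ltr_norml.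
  have := AP q1; have := AP q2; rewrite ep0 -!(addn1 (_ + _)) -?(addn1 (A q1)) !natrD natrM /q0 natrB; last exact: ltnW.
  lra.
have p0_gt0 : 0 < p0.
  rewrite lt0n; apply/eqP => p00; move: close; rewrite p00 sub0r normrN.
  rewrite ger0_norm ?mulr_ge0 // ltNge => /negP; apply.
  have h1 : (1 <= q0%:R * w)%R by apply: mulr_ege1; rewrite // ler1n.
  by apply: mulr_ege1; rewrite // ler1n.
set g := gcdn p0 q0; have g0 : 0 < g by rewrite gcdn_gt0 p0_gt0.
have [p ep] := dvdnP (dvdn_gcdl p0 q0); have [q eq] := dvdnP (dvdn_gcdr p0 q0).
rewrite -/g in ep eq.
exists p, q; split.
- by move: p0_gt0; rewrite ep muln_gt0 => /andP[].
- by move: q0_gt0; rewrite eq muln_gt0 => /andP[].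
- apply: (@leq_trans q0); first by rewrite eq leq_pmulr.
  by rewrite /q0 (leq_trans (leq_subr _ _)).
- by rewrite /coprime -(eqn_pmul2r g0) mul1n muln_gcdl -ep -eq.
apply: le_lt_trans close; rewrite ler_wpM2r // ep eq !natrM mulrAC -mulrBl normrM.
by rewrite ler_peMr // ger0_norm // ler1n.
Qed.

(** An approximation p/q of sqrt d with the invariants of its class: the absolute
norm, the residue of p/q modulo the norm, and whether the norm is negative. *)
Record scale_data := ScaleData {
  sd_p : nat; sd_q : nat; sd_norm : nat; sd_root : nat; sd_neg : bool }.

(** With z = p + q sqrt d and |p - q sqrt d| < 2^(-j), the norm n is less than
z / 2^j.  The last line is what separates approximations at distant scales. *)
Lemma scale_class (R : realType) (d Z j : nat) : 2 <= d -> nonsquare d ->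
  (2 * Num.sqrt d%:R + 1 <= Z%:R :> R)%R ->
  exists s : scale_data, let: ScaleData p q n t neg := s in
  [/\ [/\ 0 < p, 0 < q & coprime p q], 0 < n <= Z,
      p ^ 2 + neg * n = d * q ^ 2 + ~~ neg * n,
      [/\ t < n, t ^ 2 = d %[mod n] & p = t * q %[mod n]] &
      ((2 ^ j * n)%:R < p%:R + q%:R * Num.sqrt d%:R :> R)%R /\
      (p%:R + q%:R * Num.sqrt d%:R <= (2 ^ j * Z)%:R :> R)%R].
Proof.
move=> d2 nsq hZ; set w := Num.sqrt _ in hZ *.
have w2 : (w ^+ 2 = d%:R)%R by rewrite sqr_sqrtr.
have w1 : (1 <= w)%R by rewrite -[1%R]sqrtr1 ler_sqrt // ler1n ltnW.
have w0 : (0 <= w)%R by apply: le_trans w1.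
have [p [q [p0 q0 qT cop close]]] := dirichlet R w j w1.
have T1 : (1 <= (2 ^ j)%:R :> R)%R by rewrite ler1n expn_gt0.
have TR : (0 <= (2 ^ j)%:R :> R)%R by apply: le_trans T1.
have qTR : (q%:R <= (2 ^ j)%:R :> R)%R by rewrite ler_nat.
have z0 : (0 < p%:R + q%:R * w)%R by rewrite ltr_pwDl ?ltr0n // mulr_ge0.
have zhi : (p%:R + q%:R * w <= (2 ^ j * Z)%:R)%R.
  have d1 : (`|p%:R - q%:R * w| <= 1)%R.
    by rewrite (le_trans _ (ltW close)) // ler_peMr.
  have h1 : (p%:R - q%:R * w <= 1)%R by rewrite (le_trans (ler_norm _)).
  have h2 : (q%:R * w <= (2 ^ j)%:R * w)%R by rewrite ler_wpM2r.
  have h3 : ((2 ^ j)%:R * (2 * w + 1) <= (2 ^ j)%:R * Z%:R :> R)%R by rewrite ler_wpM2l.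
  rewrite natrM; lra.
pose neg := p ^ 2 < d * q ^ 2.
pose n := if neg then d * q ^ 2 - p ^ 2 else p ^ 2 - d * q ^ 2.
have ne : p ^ 2 != d * q ^ 2.
  apply/eqP => e; apply: nsq; exists p.
  have : q %| p ^ 2 by rewrite e dvdn_mull // dvdn_exp.
  rewrite -[p ^ 2]muln1 Gauss_dvdr ?coprimeXr 1?coprime_sym // dvdn1 => /eqP q1.
  by rewrite muln1 e q1 exp1n muln1.
have le_neg : neg = false -> d * q ^ 2 <= p ^ 2 by move=> h; rewrite leqNgt -/neg h.
have n0 : 0 < n.
  rewrite /n; case: ifP => h; rewrite subn_gt0 //.
  by rewrite ltn_neqAle eq_sym ne le_neg.
have en : p ^ 2 + neg * n = d * q ^ 2 + ~~ neg * n.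
  rewrite /n; case: ifP => h; rewrite ?mul1n ?mul0n ?addn0 subnKC ?le_neg //.
  exact: ltnW.
have normE : (n%:R = `|p%:R - q%:R * w| * (p%:R + q%:R * w) :> R)%R.
  rewrite -[X in (_ * X)%R]gtr0_norm // -normrM.
  have -> : ((p%:R - q%:R * w) * (p%:R + q%:R * w) = (p ^ 2)%:R - (d * q ^ 2)%:R)%R.
    by rewrite natrM !natrX -w2; ring.
  rewrite /n; case: ifP => h.
    by rewrite natrB ?(ltnW h) // distrC ger0_norm // subr_ge0 ler_nat ltnW.
  have h' := le_neg h.
  by rewrite natrB // ger0_norm // subr_ge0 ler_nat.
have zlo : ((2 ^ j * n)%:R < p%:R + q%:R * w)%R.
  by rewrite natrM normE mulrA (mulrC (2 ^ j)%:R%R) gtr_pMl.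
have nZ : n <= Z.
  have := lt_le_trans zlo zhi; rewrite ltr_nat ltn_pmul2l ?expn_gt0 //; exact: ltnW.
have pq : p ^ 2 = d * q ^ 2 %[mod n].
  have := congr1 (modn^~ n) en.
  by case: (neg); rewrite ?mul1n ?mul0n ?addn0 ?modnDr.
have cqn : coprime q n.
  rewrite /coprime; set g := gcdn q n.
  have gp : g %| p ^ 2.
    rewrite /dvdn -(modn_dvdm _ (dvdn_gcdr q n)) pq modn_dvdm ?dvdn_gcdr //.
    by rewrite -/(dvdn _ _) dvdn_mull // dvdn_exp // dvdn_gcdl.
  have : coprime g (p ^ 2) by rewrite coprimeXr // (coprime_dvdl (dvdn_gcdl q n)) // coprime_sym.
  by rewrite /coprime (gcdn_idPl gp).
have [[u v] /= uv] := coprimeP _ q0 cqn.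
have uq : u * q = 1 %[mod n].
  have -> : u * q = v * n + 1 by rewrite addnC -uv subnK // ltnW // -subn_gt0 uv.
  by rewrite modnMDl.
exists (ScaleData p q n ((p * u) %% n) neg); split=> //.
  by rewrite n0.
split; first by rewrite ltn_mod.
  rewrite modnXm expnMn -modnMml pq modnMml -mulnA -expnMn mulnC -modnMml -modnXm.
  by rewrite (mulnC q) uq modnXm exp1n modnMml mul1n.
by rewrite modnMml -mulnA -modnMmr uq modnMmr muln1.
Qed.

Lemma signed_norm (d a b n : nat) (neg : bool) :
  a ^ 2 + neg * n = d * b ^ 2 + ~~ neg * n ->
  (a%:Z ^+ 2 - d%:Z * b%:Z ^+ 2 = (-1) ^+ neg * n%:Z)%R.
Proof. by case: neg => /=; rewrite ?mul0n ?mul1n ?addn0; lia. Qed.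

(** Each scale j gets the code of its class together with j modulo a period for
which 2^period n > Z.  Scales with the same code are at least a period apart, so
their approximations differ, and their quotient is a unit. *)
Lemma small_solution (R : realType) (d Z : nat) : 2 <= d -> nonsquare d ->
  (2 * Num.sqrt d%:R + 1 <= Z%:R :> R)%R ->
  exists X Y, [/\ 0 < Y, X ^ 2 = d * Y ^ 2 + 1 &
    X <= 4 ^ (4 * Z * (trunc_log 2 Z).+1).+1 * Z ^ 2].
Proof.
move=> d2 nsq hZ; set k := (4 * Z * (trunc_log 2 Z).+1).+1.
have [f fP] := boolp.choice (fun j => scale_class R d Z j d2 nsq hZ).
pose root n := head 0 [seq t <- iota 0 n | t ^ 2 == d %[mod n]].
have rootP n t : t < n -> t ^ 2 = d %[mod n] -> root n < n /\ root n ^ 2 = d %[mod n].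
  move=> tn et; rewrite /root.
  have: t \in [seq t <- iota 0 n | t ^ 2 == d %[mod n]].
    by rewrite mem_filter mem_iota /= add0n tn andbT; apply/eqP.
  case E : [seq _ <- _ | _] => [//|t0 s] _ /=.
  have: t0 \in [seq t <- iota 0 n | t ^ 2 == d %[mod n]] by rewrite E mem_head.
  by rewrite mem_filter mem_iota /= add0n => /andP[/eqP].
pose period n := (trunc_log 2 (Z %/ n)).+1.
pose code j := let: ScaleData p q n t neg := f j in
  (neg, (j %% period n, root_code n (root n) t)).
have [||i [j [ij jk]]] := pigeonhole _ code [seq (s, x) | s <- [:: true; false], x <- codes Z] k.
- move=> j _; rewrite /code; move: (fP j); case: (f j) => p q n t neg.
  move=> [_ /andP[n0 nZ] _ [tn et _] _]; have [rn er] := rootP _ _ tn et.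
  have [b0 v0 bv] := root_code_bounds d n (root n) t n0 rn tn er et.
  apply: allpairs_f; first by case: (neg).
  rewrite [root_code _ _ _]surjective_pairing mem_codes //.
  apply: (@leq_trans (2 ^ (j %% period n) * n)); first by rewrite leq_mul2l bv orbT.
  rewrite -leq_divRL // -[X in _ <= X]muln1 muln1.
  apply: leq_trans (@trunc_logP 2 (Z %/ n) isT _); last by rewrite divn_gt0.
  by rewrite leq_exp2l // -ltnS ltn_mod.
- rewrite size_allpairs /= /k ltnS (leq_trans (leq_mul (leqnn 2) (size_codes Z))) //.
  by rewrite !mulnA.
rewrite /code; move: (fP i) (fP j); case: (f i) => p q n t neg; case: (f j) => p' q' n' t' neg'.
move=> [[p0 q0 cop] /andP[n0 nZ] e [tn et ep] [zlo zhi]].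
move=> [[p0' q0' cop'] /andP[n0' nZ'] e' [tn' et' ep'] [zlo' zhi']].
have [rn er] := rootP _ _ tn et; have [rn' er'] := rootP _ _ tn' et'.
move=> ecode; have eneg : neg = neg' := congr1 fst ecode.
have er_mod : i %% period n = j %% period n' := congr1 (fun x => x.2.1) ecode.
have eroot : root_code n (root n) t = root_code n' (root n') t' := congr1 (fun x => x.2.2) ecode.
case: (root_code_inj d _ _ _ _ _ _ n0 rn tn n0' rn' tn' er et er' et' _ eroot).
  by move=> ->.
move=> enn ett; rewrite -{}enn -{}ett -{}eneg in e' ep' zlo' er_mod *.
have w0 : (0 <= Num.sqrt d%:R :> R)%R by exact: sqrtr_ge0.
have neq : (p, q) != (p', q').
  apply/eqP => -[epp eqq]; rewrite -epp -eqq in zlo'.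
  have := lt_le_trans zlo' zhi; rewrite ltr_nat ltnNge => /negP; apply.
  have dv : period n %| j - i by rewrite -eqn_mod_dvd ?(ltnW ij) // er_mod.
  have le : period n <= j - i by rewrite dvdn_leq // subn_gt0.
  rewrite -(subnKC (ltnW ij)) expnD -mulnA leq_mul2l; apply/orP; right.
  apply: (@leq_trans (2 ^ period n * n)); last by rewrite leq_mul2r leq_exp2l // le orbT.
  by rewrite ltnW // -ltn_divLR // trunc_log_ltn.
have nn : ((p%:Z ^+ 2 - d%:Z * q%:Z ^+ 2) * (p'%:Z ^+ 2 - d%:Z * q'%:Z ^+ 2) = n%:Z ^+ 2)%R.
  by rewrite (signed_norm _ _ _ _ _ e) (signed_norm _ _ _ _ _ e') mulrACA -expr2 sqrr_sign mul1r.
have [X [Y [Y0 eXY leX]]] := norm_quotient _ _ _ _ _ _ _ n0 q0' p0 cop cop' neq nn et ep ep'.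
exists X, Y; split=> //; apply: (leq_trans leX).
rewrite -(ler_nat R).
have h1 : ((p * p' + d * q * q')%:R <= (2 ^ i * Z)%:R * (2 ^ j * Z)%:R :> R)%R.
  apply: (le_trans _ (ler_pM _ _ zhi zhi')); last 2 first.
  - by rewrite addr_ge0 // mulr_ge0.
  - by rewrite addr_ge0 // mulr_ge0.
  have w2 : (Num.sqrt d%:R ^+ 2 = d%:R :> R)%R by rewrite sqr_sqrtr.
  rewrite natrD !natrM; move: (Num.sqrt _) w0 w2 => w w0 w2; rewrite -w2.
  rewrite -subr_ge0.
  have -> : ((p%:R + q%:R * w) * (p'%:R + q'%:R * w) -
    (p%:R * p'%:R + w ^+ 2 * q%:R * q'%:R) = p%:R * q'%:R * w + p'%:R * q%:R * w)%R by ring.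
  by rewrite addr_ge0 // !mulr_ge0.
apply: (le_trans h1); rewrite -natrM ler_nat mulnACA mulnn leq_mul2r -(expnM 2 2) mul2n -addnn expnD.
by rewrite leq_mul ?orbT // leq_exp2l // ltnW // (ltn_trans ij).
Qed.

Lemma central_binS k : k.+1 * 'C(2 * k.+1, k.+1) = 2 * (2 * k + 1) * 'C(2 * k, k).
Proof.
have e1 := mul_bin_diag (2 * k.+1) k; have e2 := mul_bin_down (2 * k + 1) k.
have h1 : (2 * k.+1).-1 = 2 * k + 1 by lia.
have h2 : (2 * k + 1).-1 = 2 * k by lia.
have h3 : 2 * k + 1 - k = k.+1 by lia.
by rewrite h2 h3 in e2; rewrite -e1 h1 -!mulnA e2.
Qed.

(** The central binomial coefficient is 4^k divided by a quantity between
sqrt (2 k + 1) and sqrt (4 k). *)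
Lemma central_bin_bounds k :
  'C(2 * k, k) ^ 2 * (2 * k + 1) <= 16 ^ k /\ (0 < k -> 16 ^ k <= 4 * k * 'C(2 * k, k) ^ 2).
Proof.
elim: k => [|k [up lo]]; first by rewrite muln0 bin0.
have e : (k.+1 * 'C(2 * k.+1, k.+1)) ^ 2 = (2 * (2 * k + 1) * 'C(2 * k, k)) ^ 2.
  by rewrite central_binS.
have k0 : 0 < k.+1 ^ 2 by rewrite expn_gt0.
split=> [|_].
  rewrite -(leq_pmul2l k0) mulnA -expnMn e (expnS 16).
  move: up; move: ('C(2 * k, k)) (16 ^ k) => c P up {lo e}.
  have : c ^ 2 * (2 * k + 1) * (4 * (2 * k + 1) * (2 * k + 3)) <= P * (4 * (2 * k + 1) * (2 * k + 3)).
    by rewrite leq_mul2r up orbT.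
  lia.
case: (posnP k) => [->|k_gt0]; first by rewrite muln1 !binS.
rewrite -(leq_pmul2l k0) (mulnC (4 * k.+1)) mulnA -expnMn e (expnS 16).
move: (lo k_gt0); move: ('C(2 * k, k)) (16 ^ k) => c P h {up lo e}.
have : P * (16 * k.+1 ^ 2) <= 4 * k * c ^ 2 * (16 * k.+1 ^ 2) by rewrite leq_mul2r h orbT.
have h2 : 4 * k * k.+1 <= (2 * k + 1) ^ 2 by lia.
have := leq_mul (leqnn (16 * k.+1 * c ^ 2)) h2.
lia.
Qed.

Definition sqrt_estimate (d : nat) : nat := 4 ^ d %/ 'C(2 * d, d).

Lemma sqrt_estimate_bounds d : 0 < d ->
  [/\ 0 < sqrt_estimate d, sqrt_estimate d ^ 2 <= 4 * d & d <= (2 * sqrt_estimate d) ^ 2].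
Proof.
move=> d0; have [up /(_ d0) lo] := central_bin_bounds d.
have c0 : 0 < 'C(2 * d, d) by rewrite bin_gt0 leq_pmull.
have c2 : 0 < 'C(2 * d, d) ^ 2 by rewrite expn_gt0 c0.
set s := sqrt_estimate d.
have sq : 16 ^ d = (4 ^ d) ^ 2 by rewrite -expnM mulnC expnM.
have hs : s ^ 2 <= 4 * d.
  rewrite -(leq_pmul2r c2) (leq_trans _ lo) // -expnMn sq leq_exp2r //.
  exact: leq_divM.
have s1 : 2 * d + 1 < s.+1 ^ 2.
  rewrite -(ltn_pmul2r c2) mulnC (leq_ltn_trans up) // sq -expnMn ltn_exp2r //.
  exact: ltn_ceil.
have s0 : 0 < s by case: (s) s1 => //; rewrite exp1n addn1.
split=> //; have : s.+1 ^ 2 <= (2 * s) ^ 2 by rewrite leq_exp2r // mul2n -addnn -addn1 leq_add2l.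
by lia.
Qed.

Definition search_bound (d : nat) : nat := (2 * d) ^ (128 * sqrt_estimate d).

Lemma search_bound_large d : 2 <= d -> 16 <= search_bound d /\ d <= search_bound d.
Proof.
move=> d2; have [s0 _ _] := sqrt_estimate_bounds d (ltnW d2).
have h : (2 * d) ^ 2 <= search_bound d.
  by rewrite /search_bound leq_pexp2l ?muln_gt0 ?(ltnW d2) // (leq_trans (isT : 2 <= 128 * 1)) // leq_mul2l.
have h2 : 4 <= 2 * d by rewrite (@leq_mul 2 2).
have := leq_mul h2 h2; rewrite mulnn => h3; split; first exact: leq_trans h.
apply: leq_trans h; rewrite -mulnn; apply: leq_trans (leq_mul h2 (leqnn (2 * d))); lia.
Qed.

Lemma twenty_le_cube d : 2 <= d -> 20 * d <= (2 * d) ^ 3.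
Proof.
move=> d2; have := leq_mul (leqnn d) (leq_mul d2 d2); rewrite expnMn; lia.
Qed.

(** small_solution with Z = 4 s + 1.  Its bound is at most (2 Z)^(8 Z + 2), where
2 Z <= (2 d)^3 and 8 Z + 2 <= 42 s, and 3 * 42 < 128. *)
Lemma small_solution_lt_bound (R : realType) d : 2 <= d -> nonsquare d ->
  exists X Y, [/\ 0 < Y, X ^ 2 = d * Y ^ 2 + 1 & X < search_bound d].
Proof.
move=> d2 nsq; have [s0 s_up s_lo] := sqrt_estimate_bounds d (ltnW d2).
rewrite /search_bound; set s := sqrt_estimate d in s0 s_up s_lo *.
pose Z := 4 * s + 1.
have hZ : (2 * Num.sqrt d%:R + 1 <= Z%:R :> R)%R.
  have : (Num.sqrt d%:R <= (2 * s)%:R :> R)%R.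
    by rewrite -[leRHS]ger0_norm // -sqrtr_sqr ler_sqrt ?sqr_ge0 // -natrX ler_nat.
  rewrite /Z natrD !natrM; lra.
have [X [Y [Y0 e le]]] := small_solution R d Z d2 nsq hZ.
exists X, Y; split=> //; apply: (leq_ltn_trans le).
have sd : s <= 2 * d.
  rewrite -(@leq_exp2r _ _ 2) // (leq_trans s_up) // expnMn leq_pmul2l // -mulnn.
  by rewrite leq_pmulr // ltnW.
have Z2 : 2 * Z <= (2 * d) ^ 3.
  apply: (@leq_trans (20 * d)); first by rewrite /Z; lia.
  exact: twenty_le_cube.
set l := (trunc_log 2 Z).+1; have lZ : 2 ^ l <= 2 * Z.
  by rewrite expnS leq_mul2l trunc_logP // /Z addn1.
have step : 4 ^ (4 * Z * l).+1 * Z ^ 2 <= (2 * Z) ^ (8 * Z + 2).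
  rewrite expnS -mulnA mulnCA (expnD _ _ 2).
  have -> : 4 * Z ^ 2 = (2 * Z) ^ 2 by rewrite expnMn.
  have -> : 4 ^ (4 * Z * l) = (2 ^ l) ^ (8 * Z).
    by rewrite -[4 in LHS]/(2 ^ 2) -!expnM; congr (2 ^ _); ring.
  by rewrite leq_mul // leq_exp2r // /Z addn1.
apply: (leq_ltn_trans step).
apply: (@leq_ltn_trans (((2 * d) ^ 3) ^ (8 * Z + 2))); first by rewrite leq_exp2r // addn2.
rewrite -expnM ltn_exp2l; last by rewrite (leq_trans (isT : 1 < 2 * 2)) // leq_mul2l.
by rewrite /Z; lia.
Qed.

(** * Values of straight-line programs and their size *)

(** Division and remainder by 0 get a value here, so that every program has
values; run_values shows that they are those of the trace when no divisor is 0. *)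
Definition total_operation (o : operation) (u v : nat) : nat :=
  match o with
  | OpAdd => u + v | OpMonus => u - v | OpMul => u * v
  | OpDiv => u %/ v | OpPow => u ^ v | OpMod => u %% v
  end.

Definition operand_value (xs : seq nat) (v : nat -> nat) (a : operand) : nat :=
  match a with Input i => nth 0 xs i | Const c => c | Value j => v j end.

Definition instruction_value (xs : seq nat) (v : nat -> nat) (i : instruction) : nat :=
  match i with
  | Assign a => operand_value xs v a
  | Apply o a b => total_operation o (operand_value xs v a) (operand_value xs v b)
  end.

(** Instructions that do not divide are given the divisor 1. *)
Definition divisor (i : instruction) : operand :=
  match i with Apply OpDiv _ b | Apply OpMod _ b => b | _ => Const 1 end.

Definition scoped_operand (l k : nat) (a : operand) : bool :=
  match a with Input i => i < l | Const _ => true | Value j => j < k end.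

Definition scoped_instruction (l k : nat) (i : instruction) : bool :=
  match i with
  | Assign a => scoped_operand l k a
  | Apply _ a b => scoped_operand l k a && scoped_operand l k b
  end.

Fixpoint scoped (l k : nat) (c : seq instruction) : bool :=
  if c is i :: c' then scoped_instruction l k i && scoped l k.+1 c' else true.

Fixpoint values (xs vs : seq nat) (c : seq instruction) : seq nat :=
  if c is i :: c' then values xs (rcons vs (instruction_value xs (nth 0 vs) i)) c' else vs.

Lemma onth_nth (s : seq nat) i : i < size s -> onth s i = Some (nth 0 s i).
Proof. by elim: s i => // x s IH [|i] //= h; apply: IH. Qed.

Lemma size_values xs vs c : size (values xs vs c) = size vs + size c.
Proof. by elim: c vs => [|i c IH] vs; rewrite ?addn0 //= IH size_rcons addSnnS. Qed.

Lemma nth_values xs vs c j : j < size vs -> nth 0 (values xs vs c) j = nth 0 vs j.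
Proof.
elim: c vs => //= i c IH vs h; rewrite IH ?size_rcons 1?ltnW // nth_rcons h //.
Qed.

Lemma eq_instruction_value xs v w l k i : scoped_instruction l k i ->
  (forall j, j < k -> v j = w j) -> instruction_value xs v i = instruction_value xs w i.
Proof.
move=> sc e; have op a : scoped_operand l k a -> operand_value xs v a = operand_value xs w a.
  by case: a => //= j; apply: e.
by case: i sc => [a|o a b] /=; [exact: op|case/andP=> /op -> /op ->].
Qed.

Lemma values_eq xs vs c i : scoped (size xs) (size vs) c -> i < size c ->
  nth 0 (values xs vs c) (size vs + i) =
  instruction_value xs (nth 0 (values xs vs c)) (nth (Assign (Const 0)) c i).
Proof.
elim: c vs i => // a c IH vs [|i] /= /andP[sa sc] h.
  rewrite addn0 nth_values ?size_rcons // nth_rcons ltnn eqxx.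
  apply: (eq_instruction_value _ _ _ _ _ _ sa) => j hj.
  by rewrite nth_values ?size_rcons 1?ltnW // nth_rcons hj.
have := IH (rcons vs (instruction_value xs (nth 0 vs) a)) i.
by rewrite size_rcons addSnnS; apply.
Qed.

Lemma eval_operandE xs vs a : scoped_operand (size xs) (size vs) a ->
  eval_operand xs vs a = Some (operand_value xs (nth 0 vs) a).
Proof. by case: a => //= i; apply: onth_nth. Qed.

Lemma eval_instructionE xs vs i : scoped_instruction (size xs) (size vs) i ->
  operand_value xs (nth 0 vs) (divisor i) != 0 ->
  eval_instruction xs vs i = Some (instruction_value xs (nth 0 vs) i).
Proof.
case: i => [a|o a b] /=; first by move/eval_operandE.
case/andP=> /eval_operandE -> /eval_operandE ->.
by case: o => //= /negbTE ->.
Qed.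

Lemma eq_divisor_value xs v w l k i : scoped_instruction l k i ->
  (forall j, j < k -> v j = w j) ->
  operand_value xs v (divisor i) = operand_value xs w (divisor i).
Proof.
move=> sc e; have op a : scoped_operand l k a -> operand_value xs v a = operand_value xs w a.
  by case: a => //= j; apply: e.
by case: i sc => [a|[] a b] //= /andP[_ /op].
Qed.

Lemma run_values xs vs c : scoped (size xs) (size vs) c ->
  all (fun i => operand_value xs (nth 0 (values xs vs c)) (divisor i) != 0) c ->
  run xs vs c = Some (values xs vs c).
Proof.
elim: c vs => //= i c IH vs /andP[si sc] /andP[di dc].
have e : operand_value xs (nth 0 vs) (divisor i) != 0.
  move: di; rewrite (eq_divisor_value _ _ (nth 0 vs) _ _ _ si) // => j hj.
  by rewrite nth_values ?size_rcons 1?ltnW // nth_rcons hj.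
by rewrite eval_instructionE // IH ?size_rcons.
Qed.

(** The values of a program satisfy one equation each.  All later reasoning uses
only these equations and never evaluates the program. *)
Lemma slp_values xs p : scoped (size xs) 0 (code p) ->
  exists v : nat -> nat,
    (forall i, i < size (code p) ->
       v i = instruction_value xs v (nth (Assign (Const 0)) (code p) i)) /\
    (all (fun i => operand_value xs v (divisor i) != 0) (code p) ->
       trace p xs = Some (mkseq v (size (code p)))).
Proof.
move=> sc; exists (nth 0 (values xs [::] (code p))); split=> [i hi|nz].
  exact: (values_eq xs [::] (code p) i).
by rewrite /trace run_values // -[size (code p)](size_values xs [::]) mkseq_nth.
Qed.

(** The level (t, c) stands for n^c under t exponentials of base 2. *)
Definition tower (n : nat) (l : nat * nat) : nat := iter l.1 (expn 2) (n ^ l.2).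

Lemma tower_mono n t c t' c' : 2 <= n -> t <= t' -> c <= c' ->
  tower n (t, c) <= tower n (t', c').
Proof.
move=> n2 tt cc; rewrite /tower /= -(subnK tt); elim: (t' - t) => [|k IH].
  elim: (t) => [|m IH] /=; first by rewrite leq_pexp2l // ltnW.
  by rewrite leq_exp2l.
by rewrite (leq_trans IH) //= ltnW // ltn_expl.
Qed.

Definition mul_level (l k : nat * nat) : nat * nat :=
  if (l.1 == 0) && (k.1 == 0) then (0, l.2 + k.2) else (maxn l.1 k.1, (maxn l.2 k.2).+1).

Lemma tower_double n t c : 2 <= n -> 2 * tower n (t, c) <= tower n (t, c.+1).
Proof.
move=> n2; rewrite /tower /=; elim: t => [|t IH] /=; first by rewrite expnS leq_mul2r n2 orbT.
rewrite -expnS leq_exp2l // (leq_trans _ IH) // mul2n -addnn -addn1 leq_add2l.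
by case: t {IH} => [|t] /=; rewrite expn_gt0 // (leq_trans _ n2).
Qed.

Lemma mul_levelP n l k u v : 2 <= n -> u <= tower n l -> v <= tower n k ->
  u * v <= tower n (mul_level l k).
Proof.
move=> n2; case: l k => [t c] [t' c'] hu hv; rewrite /mul_level /=.
case: ifP => [/andP[/eqP t0 /eqP t0']|].
  by move: hu hv; rewrite t0 t0' /tower /= expnD; apply: leq_mul.
move/negbT; rewrite negb_and -!lt0n => h.
have m0 : 0 < maxn t t' by rewrite leq_max.
have := leq_mul (leq_trans hu (tower_mono n _ _ _ _ n2 (leq_maxl t t') (leq_maxl c c')))
  (leq_trans hv (tower_mono n _ _ _ _ n2 (leq_maxr t t') (leq_maxr c c'))).
move: (maxn t t') (maxn c c') m0 => [//|T] C _ h2; apply: (leq_trans h2).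
have := tower_double n T C n2; rewrite /tower /= -expnD leq_exp2l // addnn -mul2n.
by [].
Qed.

Lemma mul_level_add n l k u v : 2 <= n -> u <= tower n l -> v <= tower n k ->
  u + v <= tower n (maxn l.1 k.1, (maxn l.2 k.2).+1).
Proof.
move=> n2; case: l k => [t c] [t' c'] hu hv /=.
apply: leq_trans (tower_double _ _ _ n2); rewrite mul2n -addnn leq_add //.
  exact: (leq_trans hu (tower_mono n _ _ _ _ n2 (leq_maxl t t') (leq_maxl c c'))).
exact: (leq_trans hv (tower_mono n _ _ _ _ n2 (leq_maxr t t') (leq_maxr c c'))).
Qed.

(** A base on level t + 1 is a power of 2 whose exponent, on level t, is multiplied
by the exponent of the power. *)
Lemma pow_levelP n l k u v : 2 <= n -> u <= tower n l -> v <= tower n k ->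
  u ^ v <= tower n ((mul_level (l.1.-1, l.2) k).1.+1, (mul_level (l.1.-1, l.2) k).2).
Proof.
move=> n2 hu hv; case: (posnP v) => [->|v0].
  by rewrite expn0 /tower /= expn_gt0.
have hu' : u <= 2 ^ tower n (l.1.-1, l.2).
  apply: (leq_trans hu); case: (l) => -[|t] c //=; exact: (tower_mono n 0 c 1 c).
apply: (@leq_trans ((2 ^ tower n (l.1.-1, l.2)) ^ v)); first by rewrite leq_exp2r.
rewrite -expnM /tower [iter _ _ _]/=; rewrite leq_exp2l //.
exact: mul_levelP.
Qed.

Definition operand_level (ls : seq (nat * nat)) (a : operand) : nat * nat :=
  match a with Input _ => (0, 1) | Const c => (0, c) | Value j => nth (0, 0) ls j end.

(** A power of a level 0 value with constant exponent stays on level 0, which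
keeps n^4 and n^2 polynomial in n.  A remainder is bounded by its divisor, which
brings the binomial coefficient and the geometric sum down. *)
Definition instruction_level (ls : seq (nat * nat)) (i : instruction) : nat * nat :=
  match i with
  | Assign a => operand_level ls a
  | Apply o a b =>
      let l := operand_level ls a in let k := operand_level ls b in
      match o with
      | OpAdd => (maxn l.1 k.1, (maxn l.2 k.2).+1)
      | OpMul => mul_level l k
      | OpMonus | OpDiv => l
      | OpMod => k
      | OpPow =>
          if (l.1 == 0) && (if b is Const _ then true else false)
          then (0, l.2 * k.2)
          else ((mul_level (l.1.-1, l.2) k).1.+1, (mul_level (l.1.-1, l.2) k).2)
      end
  end.

Fixpoint levels (ls : seq (nat * nat)) (c : seq instruction) : seq (nat * nat) :=
  if c is i :: c' then levels (rcons ls (instruction_level ls i)) c' else ls.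

Definition bounded_by (n : nat) (v : nat -> nat) (ls : seq (nat * nat)) : Prop :=
  forall j, j < size ls -> v j <= tower n (nth (0, 0) ls j).

Lemma instruction_levelP n xs v ls i : 2 <= n -> all (fun x => x <= n) xs ->
  bounded_by n v ls -> scoped_instruction (size xs) (size ls) i ->
  operand_value xs v (divisor i) != 0 ->
  instruction_value xs v i <= tower n (instruction_level ls i).
Proof.
move=> n2 xn bd; have op a : scoped_operand (size xs) (size ls) a ->
    operand_value xs v a <= tower n (operand_level ls a).
  case: a => [k|c|j] /= h; last exact: bd.
    by rewrite /tower /= expn1; apply: (allP xn); rewrite mem_nth.
  by rewrite /tower /= ltnW // ltn_expl.
case: i => [a|o a b] /=; first by move/op.
case/andP=> /op ha /op hb; case: o => /= h.
- exact: mul_level_add.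
- exact: leq_trans (leq_subr _ _) ha.
- exact: mul_levelP.
- exact: leq_trans (leq_div _ _) ha.
- case: ifP => [/andP[/eqP l0]|_]; last exact: pow_levelP.
  case: b {hb h} => //= c _; move: ha; rewrite /tower l0 /= expnM => ha.
  by case: c => [|c]; rewrite ?expn0 // leq_exp2r.
by apply: leq_trans hb; rewrite ltnW // ltn_mod lt0n.
Qed.

Lemma levelsP n xs v ls c : 2 <= n -> all (fun x => x <= n) xs ->
  scoped (size xs) (size ls) c -> bounded_by n v ls ->
  (forall i, i < size c -> v (size ls + i) = instruction_value xs v (nth (Assign (Const 0)) c i)) ->
  all (fun i => operand_value xs v (divisor i) != 0) c ->
  bounded_by n v (levels ls c).
Proof.
move=> n2 xn; elim: c ls => //= i c IH ls /andP[si sc] bd ev /andP[di dc].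
apply: IH => //; rewrite ?size_rcons //.
  move=> j; rewrite size_rcons ltnS leq_eqVlt nth_rcons => /orP[/eqP ->|h].
    by rewrite ltnn eqxx; have := ev 0 isT; rewrite addn0 /= => ->; apply: instruction_levelP.
  by rewrite h; apply: bd.
by move=> j hj; rewrite addSnnS ev.
Qed.

(** * The program *)

(** Values 0 to 9.  Value 6 is C(2d, d), value 7 is sqrt_estimate d and value 9 is
n = search_bound d. *)
Definition bound_code : seq instruction :=
  [:: Apply OpPow (Const 4) (Input 0);
      Apply OpAdd (Value 0) (Const 1);
      Apply OpMul (Const 2) (Input 0);
      Apply OpPow (Value 1) (Value 2);
      Apply OpPow (Value 0) (Input 0);
      Apply OpDiv (Value 3) (Value 4);
      Apply OpMod (Value 5) (Value 0);
      Apply OpDiv (Value 0) (Value 6);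
      Apply OpMul (Const 128) (Value 7);
      Apply OpPow (Value 2) (Value 8)].

(** Values 10 to 38.  Values 10 to 14 are the powers L, 2^L, Q, Q^n and Q^(n^2).
Values 19 and 25 encode the squares of y and of x, values 20 and 26 the constant 1
in base Q and in base Q^n, value 34 the weights, and values 36 and 38 are the
numbers a and b. *)
Definition digits_code : seq instruction :=
  [:: Apply OpPow (Value 9) (Const 4);
      Apply OpPow (Const 2) (Value 10);
      Apply OpPow (Value 11) (Value 10);
      Apply OpPow (Value 12) (Value 9);
      Apply OpPow (Value 13) (Value 9);
      Apply OpMonus (Value 12) (Const 1);
      Apply OpAdd (Value 12) (Const 1);
      Apply OpMul (Value 13) (Value 16);
      Apply OpPow (Value 15) (Const 3);
      Apply OpDiv (Value 17) (Value 18);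
      Apply OpDiv (Value 13) (Value 15);
      Apply OpMonus (Value 13) (Const 1);
      Apply OpAdd (Value 13) (Const 1);
      Apply OpMul (Value 14) (Value 22);
      Apply OpPow (Value 21) (Const 3);
      Apply OpDiv (Value 23) (Value 24);
      Apply OpDiv (Value 14) (Value 21);
      Apply OpMul (Value 25) (Value 20);
      Apply OpMul (Input 0) (Value 19);
      Apply OpAdd (Value 28) (Value 20);
      Apply OpMul (Value 29) (Value 26);
      Apply OpPow (Const 2) (Value 9);
      Apply OpMul (Value 14) (Value 31);
      Apply OpMonus (Value 12) (Value 11);
      Apply OpDiv (Value 32) (Value 33);
      Apply OpAdd (Value 27) (Value 34);
      Apply OpMonus (Value 35) (Value 30);
      Apply OpDiv (Value 14) (Value 15);
      Apply OpMonus (Value 34) (Value 37)].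

(** Values 39 to 65.  Value 46 is the reduced binomial coefficient, value 54 the
power of 2 in it, value 59 its exponent, and value 65 the sum of the indices of the
solutions. *)
Definition valuation_code : seq instruction :=
  [:: Apply OpAdd (Value 36) (Value 38);
      Apply OpPow (Const 2) (Value 39);
      Apply OpAdd (Value 40) (Const 1);
      Apply OpPow (Value 41) (Value 39);
      Apply OpPow (Value 40) (Value 36);
      Apply OpDiv (Value 42) (Value 43);
      Apply OpMod (Value 44) (Value 40);
      Apply OpMod (Value 45) (Value 14);
      Apply OpPow (Value 14) (Value 14);
      Apply OpPow (Value 47) (Value 46);
      Apply OpMonus (Value 47) (Const 1);
      Apply OpDiv (Value 48) (Value 49);
      Apply OpPow (Value 14) (Value 46);
      Apply OpMonus (Value 51) (Const 1);
      Apply OpMod (Value 50) (Value 52);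
      Apply OpMod (Value 53) (Value 14);
      Apply OpPow (Value 54) (Value 10);
      Apply OpMonus (Value 11) (Const 1);
      Apply OpPow (Value 56) (Const 2);
      Apply OpMod (Value 55) (Value 57);
      Apply OpDiv (Value 58) (Value 56);
      Apply OpDiv (Value 59) (Value 10);
      Apply OpPow (Value 9) (Const 2);
      Apply OpMonus (Value 61) (Const 1);
      Apply OpMul (Value 61) (Value 62);
      Apply OpDiv (Value 63) (Const 2);
      Apply OpMonus (Value 64) (Value 60)].

(** Values 66 to 79.  Values 66 and 67 are the sums of the y and of the x, and
values 76 and 79 the fundamental solution. *)
Definition recovery_code : seq instruction :=
  [:: Apply OpMod (Value 65) (Value 9);
      Apply OpDiv (Value 65) (Value 9);
      Apply OpPow (Value 67) (Const 2);
      Apply OpPow (Value 66) (Const 2);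
      Apply OpMul (Input 0) (Value 69);
      Apply OpMonus (Value 68) (Value 70);
      Apply OpMonus (Value 71) (Value 67);
      Apply OpPow (Value 72) (Const 2);
      Apply OpMonus (Value 73) (Value 70);
      Apply OpAdd (Value 73) (Value 70);
      Apply OpDiv (Value 75) (Value 74);
      Apply OpMul (Value 72) (Value 66);
      Apply OpMul (Value 77) (Const 2);
      Apply OpDiv (Value 78) (Value 74)].

Definition pell_code : seq instruction :=
  bound_code ++ digits_code ++ valuation_code ++ recovery_code.

Definition idle : instruction := Apply OpAdd (Const 0) (Const 0).

(** The k idle additions only adjust the number of operations. *)
Definition pell_program (k : nat) : slp :=
  Slp (pell_code ++ nseq k idle) [:: Value 76; Value 79].

Lemma op_count_pell_program k : op_count (pell_program k) = 80 + k.
Proof. by rewrite /op_count /= count_nseq mul1n. Qed.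

Lemma scoped_idle l m k : scoped l m (nseq k idle).
Proof. by elim: k m => //=. Qed.

Lemma bound_values d v : 2 <= d ->
  (forall i, i < 10 -> v i = instruction_value [:: d] v (nth idle bound_code i)) ->
  [/\ v 4 != 0, v 0 != 0, v 6 != 0, v 7 = sqrt_estimate d & v 9 = search_bound d].
Proof.
move=> d2 ev.
have d0 : 0 < d by apply: ltnW.
have e0 : v 0 = 2 ^ (2 * d) by rewrite (ev 0) //= expnM.
have e1 : v 1 = v 0 + 1 := ev 1 isT.
have e2 : v 2 = 2 * d := ev 2 isT.
have e3 : v 3 = v 1 ^ v 2 := ev 3 isT.
have e4 : v 4 = v 0 ^ d := ev 4 isT.
have e5 : v 5 = v 3 %/ v 4 := ev 5 isT.
have e6 : v 6 = v 5 %% v 0 := ev 6 isT.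
have e7 : v 7 = v 0 %/ v 6 := ev 7 isT.
have e8 : v 8 = 128 * v 7 := ev 8 isT.
have e9 : v 9 = v 2 ^ v 8 := ev 9 isT.
have lt_bin i : 'C(2 * d, i) < v 0 by rewrite e0 bin_lt_exp2 // muln_gt0.
have e6' : v 6 = 'C(2 * d, d).
  rewrite e6 e5 e4 e3 e2 e1 (bin_digit (v 0)) // ?modn_small //.
  by rewrite leq_pmull.
have e7' : v 7 = sqrt_estimate d by rewrite e7 e6' e0 expnM.
split=> //.
- by rewrite e4 e0 -expnM expn_eq0.
- by rewrite e0 expn_eq0.
- by rewrite e6' -lt0n bin_gt0 leq_pmull.
by rewrite e9 e8 e7' e2.
Qed.

Lemma search_values d v n : 2 <= d -> 16 <= n -> d <= n -> v 9 = n ->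
  (forall i, 10 <= i < 66 -> v i = instruction_value [:: d] v (nth idle pell_code i)) ->
  v 65 = \sum_(i < n * n | is_sol d n i) i /\
  all (fun j => v j != 0) [:: 18; 15; 24; 21; 33; 43; 40; 14; 49; 52; 57; 56; 10].
Proof.
move=> d2 n16 dn e9 ev; have n0 : 0 < n by apply: leq_trans n16.
have e10 : v 10 = weight_step n by rewrite (ev 10) //= e9.
have e11 : v 11 = weight_base n by rewrite (ev 11) //= e10.
have e12 : v 12 = digit_base n by rewrite (ev 12) //= e10 e11.
have e13 : v 13 = row_base n by rewrite (ev 13) //= e12 e9.
have e14 : v 14 = table_size n by rewrite (ev 14) //= e13 e9.
have e15 : v 15 = v 12 - 1 := ev 15 isT.
have e16 : v 16 = v 12 + 1 := ev 16 isT.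
have e17 : v 17 = v 13 * v 16 := ev 17 isT.
have e18 : v 18 = v 15 ^ 3 := ev 18 isT.
have e19 : v 19 = v 17 %/ v 18 := ev 19 isT.
have e20 : v 20 = v 13 %/ v 15 := ev 20 isT.
have e21 : v 21 = v 13 - 1 := ev 21 isT.
have e22 : v 22 = v 13 + 1 := ev 22 isT.
have e23 : v 23 = v 14 * v 22 := ev 23 isT.
have e24 : v 24 = v 21 ^ 3 := ev 24 isT.
have e25 : v 25 = v 23 %/ v 24 := ev 25 isT.
have e26 : v 26 = v 14 %/ v 21 := ev 26 isT.
have e27 : v 27 = v 25 * v 20 := ev 27 isT.
have e28 : v 28 = d * v 19 := ev 28 isT.
have e29 : v 29 = v 28 + v 20 := ev 29 isT.
have e30 : v 30 = v 29 * v 26 := ev 30 isT.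
have e31 : v 31 = 2 ^ v 9 := ev 31 isT.
have e32 : v 32 = v 14 * v 31 := ev 32 isT.
have e33 : v 33 = v 12 - v 11 := ev 33 isT.
have e34 : v 34 = v 32 %/ v 33 := ev 34 isT.
have e35 : v 35 = v 27 + v 34 := ev 35 isT.
have e36 : v 36 = v 35 - v 30 := ev 36 isT.
have e37 : v 37 = v 14 %/ v 15 := ev 37 isT.
have e38 : v 38 = v 34 - v 37 := ev 38 isT.
have [a_digits b_digits] := search_digit_values n n16 d dn.
have a_def : v 36 = digits (digit_base n) (fun i => (i %/ n) ^ 2 + 2 ^ (n + weight_step n * i) - (d * (i %% n) ^ 2 + 1)) (n * n).
  rewrite -a_digits e36 e35 e30 e27 e34 e29 e28 e33 e32 e31 e26 e25 e24 e23 e22 e21.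
  by rewrite e20 e19 e18 e17 e16 e15 e14 e13 e12 e11 e9.
have b_def : v 38 = digits (digit_base n) (fun i => 2 ^ (n + weight_step n * i) - 1) (n * n).
  by rewrite -b_digits e38 e37 e34 e33 e32 e31 e15 e14 e12 e11 e9.
have e39 : v 39 = v 36 + v 38 := ev 39 isT.
have e40 : v 40 = 2 ^ v 39 := ev 40 isT.
have e41 : v 41 = v 40 + 1 := ev 41 isT.
have e42 : v 42 = v 41 ^ v 39 := ev 42 isT.
have e43 : v 43 = v 40 ^ v 36 := ev 43 isT.
have e44 : v 44 = v 42 %/ v 43 := ev 44 isT.
have e45 : v 45 = v 44 %% v 40 := ev 45 isT.
have e46 : v 46 = v 45 %% v 14 := ev 46 isT.
have e47 : v 47 = v 14 ^ v 14 := ev 47 isT.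
have e48 : v 48 = v 47 ^ v 46 := ev 48 isT.
have e49 : v 49 = v 47 - 1 := ev 49 isT.
have e50 : v 50 = v 48 %/ v 49 := ev 50 isT.
have e51 : v 51 = v 14 ^ v 46 := ev 51 isT.
have e52 : v 52 = v 51 - 1 := ev 52 isT.
have e53 : v 53 = v 50 %% v 52 := ev 53 isT.
have e54 : v 54 = v 53 %% v 14 := ev 54 isT.
have e55 : v 55 = v 54 ^ v 10 := ev 55 isT.
have e56 : v 56 = v 11 - 1 := ev 56 isT.
have e57 : v 57 = v 56 ^ 2 := ev 57 isT.
have e58 : v 58 = v 55 %% v 57 := ev 58 isT.
have e59 : v 59 = v 58 %/ v 56 := ev 59 isT.
have e60 : v 60 = v 59 %/ v 10 := ev 60 isT.
have e61 : v 61 = v 9 ^ 2 := ev 61 isT.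
have e62 : v 62 = v 61 - 1 := ev 62 isT.
have e63 : v 63 = v 61 * v 62 := ev 63 isT.
have e64 : v 64 = v 63 %/ 2 := ev 64 isT.
have e65 : v 65 = v 64 - v 60 := ev 65 isT.
have [r0 index_sum] := search_index n n16 d dn.
have r_def : v 46 = (((2 ^ (v 36 + v 38) + 1) ^ (v 36 + v 38) %/ (2 ^ (v 36 + v 38)) ^ v 36)
    %% 2 ^ (v 36 + v 38)) %% table_size n.
  by rewrite e46 e45 e44 e43 e42 e41 e40 e39 e14.
split.
  rewrite -index_sum -a_def -b_def -r_def.
  rewrite e65 e64 e63 e62 e61 e60 e59 e58 e57 e56 e55 e54 e53 e52 e51 e50 e49 e48 e47.
  by rewrite e14 e11 e10 e9.
rewrite -a_def -b_def -r_def in r0.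
have Q2 := digit_base_gt2 n n16; have p2 := leq_trans Q2 (row_base_ge n n16).
have M2 := table_size_gt2 n n16; have M0 : 0 < table_size n by apply: ltnW; apply: ltnW.
have pred_neq0 k : 1 < k -> k - 1 != 0 by rewrite -lt0n subn_gt0.
have MX e : 0 < e -> 1 < table_size n ^ e.
  by move=> e0; rewrite -(exp1n e) ltn_exp2r // ltnW.
have h15 : v 15 != 0 by rewrite e15 e12 pred_neq0 // ltnW.
have h21 : v 21 != 0 by rewrite e21 e13 pred_neq0 // ltnW.
have h40 : v 40 != 0 by rewrite e40 expn_eq0.
have h56 : v 56 != 0 by rewrite e56 e11 pred_neq0 // weight_base_gt1.
rewrite /= h15 h21 h40 h56 e18 e24 e43 e57 !expn_eq0 (negbTE h15) (negbTE h21).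
rewrite (negbTE h40) (negbTE h56) e33 e12 e11 e14 e49 e47 e14 e52 e51 e14 e10.
rewrite !pred_neq0 ?MX // -!lt0n M0 expn_gt0 n0 andbT /=.
by rewrite subn_gt0 weight_base_lt.
Qed.

Lemma minimal_solution_exists (R : realType) d : 2 <= d -> nonsquare d ->
  exists X Y, minimal_solution d X Y /\ X < search_bound d.
Proof.
move=> d2 nsq; have [X0 [Y0 [Y0_gt0 e0 X0_lt]]] := small_solution_lt_bound R d d2 nsq.
have d0 : 0 < d by apply: ltnW.
pose P x := has (fun y => x ^ 2 == d * y ^ 2 + 1) (iota 1 x).
have PP x y : 0 < y -> x ^ 2 = d * y ^ 2 + 1 -> P x.
  move=> y0 e; apply/hasP; exists y; last exact/eqP.
  rewrite mem_iota y0 add1n ltnS -(@leq_exp2r _ _ 2) // e.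
  by rewrite (leq_trans (leq_pmull _ d0)) ?leq_addr.
have exP : exists x, P x by exists X0; apply: PP e0.
case: (ex_minnP exP) => X /hasP[Y]; rewrite mem_iota => /andP[Y_gt0 _] /eqP e min.
exists X, Y; split; last by apply: leq_ltn_trans (min _ (PP _ _ Y0_gt0 e0)) X0_lt.
by split=> // x y y0 exy; apply: min; apply: PP exy.
Qed.

Lemma minimal_fundamental d X Y : 0 < d -> minimal_solution d X Y ->
  fundamental_solution d X Y.
Proof.
move=> d0 [Y0 e min]; have pellE (x y : nat) : pell d x y <-> x ^ 2 = d * y ^ 2 + 1.
  rewrite /pell !expr2 -!PoszM !mulnn; split=> [/eqP|->].
    by rewrite subr_eq addrC -PoszD eqz_nat addnC => /eqP.
  by rewrite PoszD addrAC subrr add0r.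
split=> //; first exact: ltnW (pell_gt1 d X Y d0 Y0 e).
  exact/pellE.
case=> [x|//] [y|//]; rewrite !ltz_nat lez_nat => x0 y0 /pellE; exact: min.
Qed.

Lemma pellx_gt d X Y k : 0 < d -> 0 < Y -> X ^ 2 = d * Y ^ 2 + 1 -> k < pellx d X Y k.
Proof.
move=> d0 Y0 e; elim: k => [|k IH] //.
exact: leq_ltn_trans IH (pellx_lt d X Y k d0 Y0 e).
Qed.

Lemma last_power d X Y n : 0 < d -> 0 < Y -> X ^ 2 = d * Y ^ 2 + 1 -> X < n ->
  exists r, [/\ 0 < r, pellx d X Y r < n & n <= pellx d X Y r.+1].
Proof.
move=> d0 Y0 e Xn.
have p1 : pellx d X Y 1 < n by rewrite /pellx /= muln1 muln0 addn0.
have ex : exists k, pellx d X Y k < n by exists 1.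
have ub k : pellx d X Y k < n -> k <= n.
  by move=> h; apply: ltnW (ltn_trans (pellx_gt d X Y k d0 Y0 e) h).
case: (ex_maxnP ex ub) => r rn max; exists r; split=> //; first exact: max.
by rewrite leqNgt; apply/negP => /max; rewrite ltnn.
Qed.

Lemma pell_values d v n X Y : 2 <= d -> minimal_solution d X Y -> X < n ->
  16 <= n -> d <= n -> v 9 = n ->
  (forall i, 10 <= i < 80 -> v i = instruction_value [:: d] v (nth idle pell_code i)) ->
  [/\ v 76 = X, v 79 = Y, v 74 != 0 &
    all (fun j => v j != 0) [:: 18; 15; 24; 21; 33; 43; 40; 14; 49; 52; 57; 56; 10]].
Proof.
move=> d2 mXY Xn n16 dn e9 ev; have [Y0 e _] := mXY.
have d0 : 0 < d by apply: ltnW.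
have [|v65 nz] := search_values d v n d2 n16 dn e9.
  by move=> i /andP[i10 i66]; apply: ev; rewrite i10 (ltn_trans i66).
have [r [r0 rn nr]] := last_power d X Y n d0 Y0 e Xn.
have [h0 hX hY] := pell_recover d X Y r d0 Y0 r0 e.
have := sum_solutions d X Y n r d0 mXY rn nr; rewrite -v65.
have := sum_pelly_le d X Y r d2 mXY.
move: h0 hX hY.
move: (\sum_(k < r.+1) pellx d X Y k) (\sum_(k < r.+1) pelly d X Y k) => sx sy h0 hX hY sy_le e65.
have sy_n : sy < n by apply: leq_ltn_trans rn.
have e66 : v 66 = sy.
  by rewrite (ev 66) //= e65 e9 modnMDl modn_small.
have e67 : v 67 = sx.
  by rewrite (ev 67) //= e65 e9 divnMDl ?divn_small ?addn0 // (leq_trans _ n16).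
have e68 : v 68 = v 67 ^ 2 := ev 68 isT.
have e69 : v 69 = v 66 ^ 2 := ev 69 isT.
have e70 : v 70 = d * v 69 := ev 70 isT.
have e71 : v 71 = v 68 - v 70 := ev 71 isT.
have e72 : v 72 = v 71 - v 67 := ev 72 isT.
have e73 : v 73 = v 72 ^ 2 := ev 73 isT.
have e74 : v 74 = v 73 - v 70 := ev 74 isT.
have e75 : v 75 = v 73 + v 70 := ev 75 isT.
have e76 : v 76 = v 75 %/ v 74 := ev 76 isT.
have e77 : v 77 = v 72 * v 66 := ev 77 isT.
have e78 : v 78 = v 77 * 2 := ev 78 isT.
have e79 : v 79 = v 78 %/ v 74 := ev 79 isT.
split=> //.
- by rewrite e76 e75 e74 e73 e72 e71 e70 e69 e68 e67 e66.
- by rewrite e79 e78 e77 e74 e73 e72 e71 e70 e69 e68 e67 e66.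
by rewrite e74 e73 e72 e71 e70 e69 e68 e67 e66 -lt0n.
Qed.

Lemma nth_pell_program k i : i < 80 ->
  nth (Assign (Const 0)) (code (pell_program k)) i = nth idle pell_code i.
Proof. by move=> hi; rewrite nth_cat hi (set_nth_default idle). Qed.

Lemma size_pell_program k : size (code (pell_program k)) = 80 + k.
Proof. by rewrite size_cat size_nseq. Qed.

Lemma scoped_pell_program k : scoped 1 0 (code (pell_program k)).
Proof. by rewrite /= scoped_idle. Qed.

Lemma program_values (R : realType) d k v : 2 <= d -> nonsquare d ->
  (forall i, i < 80 -> v i = instruction_value [:: d] v (nth idle pell_code i)) ->
  exists X Y, [/\ minimal_solution d X Y, v 76 = X, v 79 = Y, v 9 = search_bound d &
    all (fun i => operand_value [:: d] v (divisor i) != 0) (code (pell_program k))].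
Proof.
move=> d2 nsq ev; have [X [Y [mXY Xn]]] := minimal_solution_exists R d d2 nsq.
have [n16 dn] := search_bound_large d d2.
have [|h4 h0 h6 e7 e9] := bound_values d v d2.
  by move=> i i10; rewrite ev ?(ltn_trans i10) // nth_cat i10.
have [|e76 e79 h74 nz] := pell_values d v _ X Y d2 mXY Xn n16 dn e9.
  by move=> i /andP[_ i80]; apply: ev.
exists X, Y; split; [exact: mXY|exact: e76|exact: e79|exact: e9|].
rewrite all_cat; apply/andP; split; last by rewrite all_nseq orbT.
have n0 : v 9 != 0 by rewrite e9 -lt0n (leq_trans _ n16).
by rewrite /= h4 h0 h6 n0 h74 !(allP nz).
Qed.

(** * Correctness and bit lengths *)

(** Value 9 is n itself, on level (0, 1), although its exponent is too large for
the level calculus.  The levels are therefore computed for values 0 to 8, restarted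
with that of value 9, and computed for the others. *)
Lemma pell_program_run (R : realType) d k : 2 <= d -> nonsquare d ->
  exists v X Y, [/\ minimal_solution d X Y, v 76 = X, v 79 = Y,
    trace (pell_program k) [:: d] = Some (mkseq v (80 + k)) &
    forall i, i < 80 + k -> v i <= 2 ^ (2 ^ (search_bound d ^ 129))].
Proof.
move=> d2 nsq; have [v [ev tr]] := slp_values [:: d] (pell_program k) (scoped_pell_program k).
rewrite size_pell_program in ev tr.
have ev80 i : i < 80 -> v i = instruction_value [:: d] v (nth idle pell_code i).
  by move=> hi; rewrite -(nth_pell_program k) // -ev // ltn_addr.
have [X [Y [mXY e76 e79 e9 nz]]] := program_values R d k v d2 nsq ev80.
exists v, X, Y; split; [exact: mXY|exact: e76|exact: e79|exact: tr|].
move=> i hi; have [n16 dn] := search_bound_large d d2.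
have n2 : 2 <= search_bound d by apply: leq_trans n16.
case: (leqP 80 i) => i80.
  by rewrite ev // nth_cat ltnNge i80 /= nth_nseq; case: ifP.
rewrite all_cat in nz; case/andP: nz => nz _.
pose n := search_bound d.
pose ls := levels [::] (take 9 bound_code).
have b1 : bounded_by n v ls.
  apply: (levelsP n [:: d]) => //; first by rewrite /= dn.
    by move=> [|[|[|[|[|[|[|[|[|j]]]]]]]]] // _; apply: ev80.
  by move: nz; rewrite -(cat_take_drop 9 pell_code) all_cat => /andP[].
have b2 : bounded_by n v (rcons ls (0, 1)).
  move=> j; rewrite size_rcons ltnS leq_eqVlt nth_rcons => /orP[/eqP ->|h].
    by rewrite ltnn eqxx /tower /= expn1 e9.
  by rewrite h; apply: b1.
have b3 : bounded_by n v (levels (rcons ls (0, 1)) (drop 10 pell_code)).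
  apply: (levelsP n [:: d]) => //; first by rewrite /= dn.
    move=> j hj; rewrite ev80; first by rewrite nth_drop (set_nth_default idle).
    have : 10 + j < 10 + 70 by rewrite ltn_add2l.
    by [].
  by move: nz; rewrite -(cat_take_drop 10 pell_code) all_cat => /andP[].
have small : all (fun l => (l.1 <= 2) && (l.2 <= 129))
    (levels (rcons ls (0, 1)) (drop 10 pell_code)) by vm_compute.
have sz : size (levels (rcons ls (0, 1)) (drop 10 pell_code)) = 80 by vm_compute.
move: (levels _ _) b3 small sz => lv b3 small sz.
apply: leq_trans (b3 i _) _; rewrite ?sz //.
have := allP small _ (mem_nth (0, 0) (_ : i < size lv)); rewrite sz => /(_ i80).
case: (nth _ _ _) => t c /andP[t2 c129]; exact: (tower_mono n t c 2 129).
Qed.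

Lemma solves_pell_program (R : realType) k : solves_pell (pell_program k).
Proof.
move=> d d2 nsq; have [v [X [Y [mXY e76 e79 tr _]]]] := pell_program_run R d k d2 nsq.
exists X, Y; split; first by apply: minimal_fundamental => //; apply: ltnW.
exists (mkseq v (80 + k)) => //.
have out j : j < 80 -> onth (mkseq v (80 + k)) j = Some (v j).
  by move=> hj; rewrite onth_nth ?size_mkseq ?ltn_addr // nth_mkseq // ltn_addr.
rewrite -e76 -e79.
exact: (congr2 (fun a b => [:: a; b]) (out 76 isT) (out 79 isT)).
Qed.

(** n^130 = (2d)^(128 s 130), with s <= 2 sqrt d and log (2d) <= 2 log d. *)
Lemma search_bound_le (R : realType) d : 2 <= d ->
  ((search_bound d ^ 130)%:R <= expR (128 * 130 * 4 * (Num.sqrt d%:R * ln d%:R)) :> R)%R.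
Proof.
move=> d2; have [_ s_up _] := sqrt_estimate_bounds d (ltnW d2).
rewrite /search_bound -expnM natrX.
have d0 : (0 < (2 * d)%:R :> R)%R by rewrite ltr0n muln_gt0 (ltnW d2).
have dR : (2 <= d%:R :> R)%R by rewrite ler_nat.
rewrite -[X in (X ^+ _)%R]lnK ?posrE // -expRM_natl ler_expR.
have s_sqrt : ((sqrt_estimate d)%:R <= 2 * Num.sqrt d%:R :> R)%R.
  rewrite -(@ler_pXn2r _ 2) ?nnegrE ?mulr_ge0 ?sqrtr_ge0 // exprMn sqr_sqrtr //.
  by rewrite -natrX -[(2 ^+ 2)%R](natrX _ 2 2) -natrM ler_nat.
have ln_2d : (ln (2 * d)%:R <= 2 * ln d%:R :> R)%R.
  have dp : (0 < d%:R :> R)%R by rewrite ltr0n ltnW.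
  have -> : (2 * ln d%:R = ln d%:R + ln d%:R :> R)%R by ring.
  by rewrite natrM lnM ?posrE // lerD2r ler_ln ?posrE.
have ln0 : (0 <= ln (2 * d)%:R :> R)%R.
  by rewrite ln_ge0 // ler1n muln_gt0 (ltnW d2).
have -> : (128 * 130 * 4 * (Num.sqrt d%:R * ln d%:R) =
  128 * (2 * Num.sqrt d%:R) * 130 * (2 * ln d%:R) :> R)%R by ring.
by rewrite (natrM _ _ 130) natrM ler_pM ?mulr_ge0 // ler_wpM2r // ler_wpM2l.
Qed.

Lemma bit_length_pell_program (R : realType) k d vs w : 2 <= d -> nonsquare d ->
  trace (pell_program k) [:: d] = Some vs -> w \in vs ->
  ((bit_length w)%:R <= 2 `^ expR (128 * 130 * 4 * (Num.sqrt d%:R * ln d%:R)) :> R)%R.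
Proof.
move=> d2 nsq tr; have [v [X [Y [_ _ _ tr' small]]]] := pell_program_run R d k d2 nsq.
move: tr; rewrite tr' => -[<-] /mapP[i]; rewrite mem_iota add0n => hi -> {w}.
have [n16 _] := search_bound_large d d2.
apply: (@le_trans _ _ (2 `^ (search_bound d ^ 130)%:R)%R); last first.
  by apply: ler_powR; [rewrite ler1n|exact: search_bound_le].
rewrite powR_mulrn // -natrX ler_nat /bit_length.
apply: (@leq_trans (2 ^ (search_bound d ^ 129)).+1).
  by rewrite ltnS -(leq_exp2l _ _ (isT : 1 < 2)) ; case: (posnP (v i)) => [->|v0]; rewrite ?trunc_log0 ?expn_gt0 // (leq_trans (trunc_logP _ v0)) ?small.
by rewrite ltn_exp2l // ltn_exp2l // (leq_trans _ n16).
Qed.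

Lemma powR2E (R : realType) (x : R) : (2 `^ x = expR (x * ln 2))%R.
Proof. by rewrite /powR pnatr_eq0. Qed.

Lemma bit_length_double (R : realType) k (a : R) (f : nat -> R) : (0 < a)%R ->
  (forall d : nat, 2 <= d -> (Num.sqrt d%:R * ln d%:R <= a * f d)%R) ->
  bit_length_bound (pell_program k) (fun t : R => 2 `^ (2 `^ t))%R f.
Proof.
move=> a0 hf; have l0 : (0 < ln 2 :> R)%R by rewrite ln_gt0 // ltr1n.
pose c : R := (128 * 130 * 4)%R; have c0 : (0 < c)%R by rewrite !mulr_gt0.
exists (c * a / ln 2)%R; first by rewrite divr_gt0 // mulr_gt0.
move=> d d2 nsq vs tr w hw; apply: (le_trans (bit_length_pell_program R k d vs w d2 nsq tr hw)).
apply: ler_powR; first by rewrite ler1n.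
rewrite powR2E ler_expR -/c [leRHS]mulrAC divfK ?gt_eqF // -[leRHS]mulrA.
rewrite ler_wpM2l ?(ltW c0) //.
exact: hf.
Qed.

(** t <= 2^(t / ln 2), since exp t >= 1 + t. *)
Lemma bit_length_triple (R : realType) k (a : R) (f : nat -> R) : (0 < a)%R ->
  (forall d : nat, 2 <= d -> (Num.sqrt d%:R * ln d%:R <= a * f d)%R) ->
  bit_length_bound (pell_program k) (fun t : R => 2 `^ (2 `^ (2 `^ t)))%R f.
Proof.
move=> a0 hf; have l0 : (0 < ln 2 :> R)%R by rewrite ln_gt0 // ltr1n.
have [C C0 hC] := bit_length_double R k a f a0 hf.
exists (C / ln 2)%R; first by rewrite divr_gt0.
move=> d d2 nsq vs tr w hw; apply: (le_trans (hC d d2 nsq vs tr w hw)).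
do 2 (apply: ler_powR; first by rewrite ler1n).
rewrite powR2E [X in expR X]mulrAC divfK ?gt_eqF //.
by apply: le_trans (expR_ge1Dx _); rewrite lerDr.
Qed.

Lemma sqrt_ln_le (R : realType) (d : nat) : 2 <= d ->
  (Num.sqrt d%:R * ln d%:R <= 2 * d%:R :> R)%R.
Proof.
move=> d2; have d0 : (0 < d%:R :> R)%R by rewrite ltr0n ltnW.
have w0 : (0 < Num.sqrt d%:R :> R)%R by rewrite sqrtr_gt0.
have w2 : (Num.sqrt d%:R ^+ 2 = d%:R :> R)%R by rewrite sqr_sqrtr // ltW.
move: (Num.sqrt _) w0 w2 => w w0 w2; rewrite -w2 lnXn // mulrnAr -mulr_natl.
by rewrite ler_wpM2l // expr2 ler_wpM2l ?(ltW w0) // ltW // ln_sublinear.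
Qed.

Local Open Scope ring_scope.

Theorem mainTheorem4 (R : realType) :
  exists A1 A2 A3 A4 : slp,
    [/\ solves_pell A1, solves_pell A2, solves_pell A3 & solves_pell A4] /\
    [/\ op_count A1 = 94%N /\
        bit_length_bound A1 (fun t : R => 2 `^ (2 `^ (2 `^ t)))
          (fun d => d%:R),
        op_count A2 = 98%N /\
        bit_length_bound A2 (fun t : R => 2 `^ (2 `^ t))
          (fun d => d%:R),
        op_count A3 = 103%N /\
        bit_length_bound A3 (fun t : R => 2 `^ (2 `^ (2 `^ t)))
          (fun d => Num.sqrt d%:R * ln d%:R) &
        op_count A4 = 107%N /\
        bit_length_bound A4 (fun t : R => 2 `^ (2 `^ t))
          (fun d => Num.sqrt d%:R * ln d%:R)].
Proof.
exists (pell_program 14), (pell_program 18), (pell_program 23), (pell_program 27).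
split; first by split; exact: solves_pell_program R _.
have bound1 (d : nat) : (2 <= d)%N ->
    Num.sqrt d%:R * ln d%:R <= 1 * (Num.sqrt d%:R * ln d%:R) :> R by rewrite mul1r.
split; (split; first exact: op_count_pell_program).
- by apply: (bit_length_triple R _ 2) => // d; exact: sqrt_ln_le.
- by apply: (bit_length_double R _ 2) => // d; exact: sqrt_ln_le.
- exact: (bit_length_triple R _ 1 _ ltr01 bound1).
- exact: (bit_length_double R _ 1 _ ltr01 bound1).
Qed.
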